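(* Let $t>0$, $1\le p\le\infty$, let $q$ be the Hölder conjugate of $p$ ($\frac1p+\frac1q=1$), let $\mathbf{x}_0^{A},\mathbf{x}_0^{B}\in\mathbb{R}^n$, and let $\ell^{A},\ell^{B}:[0,t]\to\mathbb{R}_{>0}$ be smooth. For each agent $i\in\{A,B\}$ let $\mathcal{X}_t^i\subset\mathbb{R}^n$ be the reach set at time $t$ of the integrator dynamics $\dot{\mathbf{x}}=\mathbf{A}\mathbf{x}+\mathbf{B}\mathbf{u}$ (with $n$ states, $m$ inputs and relative degree $\mathbf{r}$) from initial condition $\mathbf{x}_0^i$ with input sets $\mathcal{U}^i(s)=\{\mathbf{u}\in\mathbb{R}^m : \|\mathbf{u}\|_p\le \ell^i(s)\}$, $0\le s\le t$. Set $$\mathbf{c}(t):=\exp(t\mathbf{A})(\mathbf{x}_0^{A}-\mathbf{x}_0^{B}),\qquad \mathbf{G}(s):=(\ell^{A}(s)+\ell^{B}(s))\exp(s\mathbf{A})\mathbf{B}.$$ Define $$p^*:=\min_{\mathbf{y}\in\mathbb{R}^n,\ \|\mathbf{y}\|_2=1}\ h_{\mathcal{X}_t^{A}}(\mathbf{y})+h_{\mathcal{X}_t^{B}}(-\mathbf{y}),$$ $$\tilde p^*:=\min_{\mathbf{y}\in\mathbb{R}^n,\ \|\mathbf{y}\|_2\le1}\ \langle\mathbf{c}(t),\mathbf{y}\rangle+\int_0^t\|\mathbf{G}(s)^\top\mathbf{y}\|_q\,ds .$$ For $K\in\mathbb{N}$ let $\Delta s:=t/K$, $s_k:=k\Delta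 s$ ($k=0,\dots,K$), and let $\tilde p^*_\varepsilon$ be the optimal value of the problem obtained by replacing the integral by its trapezoidal approximation with step $\Delta s$, in epigraph form, where $\varepsilon>0$ is the local truncation error due to this numerical approximation of the integral ($\varepsilon\downarrow0$ as $\Delta s\downarrow 0$): minimize, over $\boldsymbol{\eta}=(\mathbf{y},\boldsymbol{\theta})$ with $\mathbf{y}\in\mathbb{R}^n$, $\boldsymbol{\theta}=(\theta_0,\dots,\theta_K)\in\mathbb{R}^{K+1}$, $$\langle\mathbf{c}(t),\mathbf{y}\rangle+\langle\boldsymbol{\omega},\boldsymbol{\theta}\rangle,\qquad \boldsymbol{\omega}:=\Delta s\,(1/2,1,\dots,1,1/2)^\top\in\mathbb{R}^{K+1},$$ subject to $\|\mathbf{G}(s_k)^\top\mathbf{y}\|_q\le\theta_k$ for all $k=0,\dots,K$, $\theta_k\ge0$ for all $k=0,\dots,K$, and $\|\mathbf{y}\|_2\le1$. Then: (i) $\tilde p^*=\lim_{\varepsilon\downarrow0}\tilde p^*_\varepsilon$. (ii) $\tilde p^*\le0$. (iii) If $\tilde p^*=0$ then $0\le p^*$; and $0\le p^*$ is equivalent to $\mathcal{X}_t^{A}$ and $\mathcal{X}_t^{B}$ intersecting. (iv) If $\tilde p^*<0$ then $\tilde p^*=p^*<0$; and $p^*<0$ is equivalent to $\mathcal{X}_t^{A}$ and $\mathcal{X}_t^{B}$ being disjoint.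
   Context: Integrator dynamics with $n$ states, $m$ inputs and relative degree $\mathbf{r}=(r_1,\dots,r_m)^\top\in\mathbb{N}^m$, $r_j\ge1$, $r_1+\cdots+r_m=n$: $\dot{\mathbf{x}}=\mathbf{A}\mathbf{x}+\mathbf{B}\mathbf{u}$, where $\mathbf{A}$ is block diagonal with diagonal blocks $\mathbf{A}_1,\dots,\mathbf{A}_m$ and $\mathbf{B}\in\mathbb{R}^{n\times m}$ is block diagonal with diagonal blocks $\mathbf{b}_1,\dots,\mathbf{b}_m$. Here $\mathbf{A}_j\in\mathbb{R}^{r_j\times r_j}$ has columns $(\mathbf{0}\,|\,\mathbf{e}_1\,|\,\mathbf{e}_2\,|\cdots|\,\mathbf{e}_{r_j-1})$ (ones on the first superdiagonal, zeros elsewhere) and $\mathbf{b}_j=\mathbf{e}_{r_j}\in\mathbb{R}^{r_j}$ is the last standard basis vector. The labels $A,B$ used as superscripts name the two agents and are unrelated to the matrices $\mathbf{A},\mathbf{B}$. The reach set $\mathcal{X}_t$ at time $t$ from initial condition $\mathbf{x}_0$ with compact input sets $\mathcal{U}(s)\subset\mathbb{R}^m$ ($0\le s\le t$) is the set of all $\mathbf{x}(t)\in\mathbb{R}^n$ where $\mathbf{x}(\cdot)$ solves $\dot{\mathbf{x}}=\mathbf{A}\mathbf{x}+\mathbf{B}\mathbf{u}$, $\mathbf{x}(0)=\mathbf{x}_0$, for some measurable $\mathbf{u}(\cdot)$ with $\mathbf{u}(s)\in\mathcal{U}(s)$ for all $0\le s\le t$. It is compact and convex. The support function of a compact convex set $\mathcal{K}\subset\mathbb{R}^n$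 is $h_{\mathcal{K}}(\mathbf{y})=\sup_{\mathbf{x}\in\mathcal{K}}\langle\mathbf{y},\mathbf{x}\rangle$ for $\mathbf{y}$ in the unit sphere $\mathbb{S}^{n-1}$, with the Euclidean inner product.
   Formalization: G(s) is corrected to (ℓ^A(t−s)+ℓ^B(t−s))exp(sA)B: with ℓ^A(s)+ℓ^B(s) as printed, (iii) fails, e.g. for m=1, r=2, t=1, ℓ^A=ℓ^B=1+s, x_0^B=0, x_0^A=(4/3,−3). *)

(* Defs.v *)
From HB Require Import structures.
From mathcomp Require Import all_boot all_order all_algebra.
From mathcomp Require Import all_classical all_reals all_analysis.

Set Implicit Arguments.
Unset Strict Implicit.
Unset Printing Implicit Defensive.

Import Order.TTheory GRing.Theory Num.Theory.
Import numFieldNormedType.Exports.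
Local Open Scope classical_set_scope.
Local Open Scope ring_scope.

Definition dot (R : realType) (n : nat) (x y : 'cV[R]_n) : R :=
  \sum_(i < n) x i 0 * y i 0.

Definition norm2 (R : realType) (n : nat) (x : 'cV[R]_n) : R :=
  Num.sqrt (dot x x).

(* Only meant for 1 <= p; the value at p = -oo is junk. *)
Definition pnorm (R : realType) (n : nat) (p : \bar R) (x : 'cV[R]_n) : R :=
  match p with
  | EFin a => (\sum_(i < n) `|x i 0| `^ a) `^ a^-1
  | +oo%E => \big[Num.max/0]_(i < n) `|x i 0|
  | -oo%E => 0
  end.

(* Entrywise sum of the exponential series. *)
Definition expm (R : realType) (n : nat) (M : 'M[R]_n) : 'M[R]_n :=
  \matrix_(i, j) limn (series (fun k : nat => (k`!%:R)^-1 * (M ^+ k) i j)).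

Definition Ablock (R : realType) (k : nat) : 'M[R]_k :=
  \matrix_(i, j) (i.+1 == j :> nat)%:R.

Definition bblock (R : realType) (k : nat) : 'cV[R]_k :=
  \col_i (i.+1 == k :> nat)%:R.

Definition Amx (R : realType) (m : nat) (r : 'I_m -> nat) :
    'M[R]_(\sum_(j < m) r j) :=
  \mxdiag_(j < m) Ablock R (r j).

(* The j-th block row is (0 | ... | b_j | ... | 0), with b_j in column j. *)
Definition Bmx (R : realType) (m : nat) (r : 'I_m -> nat) :
    'M[R]_(\sum_(j < m) r j, m) :=
  \mxcol_(j < m) (bblock R (r j) *m delta_mx 0 j).

(* Smoothness on the closed interval [0, t]: l is the restriction to [0, t] of
   a C^infinity function on the real line; values of l outside [0, t] are
   irrelevant. *)
Definition smooth_on (R : realType) (t : R) (l : R -> R) : Prop :=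
  exists g : R -> R,
    (forall (k : nat) (s : R), derivable (derive1n k g) s 1) /\
    (forall s : R, 0 <= s <= t -> l s = g s).

(* Solution on [0, t], in the sense of Caratheodory, of x' = A x + B u,
   x(0) = x0, for a measurable input u: x is continuous and satisfies the
   integral equation, with the Lebesgue integral taken componentwise. *)
Definition is_solution (R : realType) (n m : nat) (A : 'M[R]_n)
    (B : 'M[R]_(n, m)) (t : R) (x0 : 'cV[R]_n)
    (u : R -> 'cV[R]_m) (x : R -> 'cV[R]_n) : Prop :=
  forall i : 'I_n,
    {within `[0, t], continuous (fun s : R => x s i 0)} /\
    (forall tau : R, 0 <= tau <= t ->
       x tau i 0 = x0 i 0 +
         \int[lebesgue_measure]_(s in `[0, tau]) (A *m x s + B *m u s) i 0).

Definition reach_set (R : realType) (n m : nat) (A : 'M[R]_n)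
    (B : 'M[R]_(n, m)) (t : R) (x0 : 'cV[R]_n) (U : R -> set 'cV[R]_m) :
    set 'cV[R]_n :=
  [set z | exists (u : R -> 'cV[R]_m) (x : R -> 'cV[R]_n),
     [/\ forall j : 'I_m, measurable_fun `[0, t] (fun s : R => u s j 0),
         forall s : R, 0 <= s <= t -> U s (u s),
         is_solution A B t x0 u x
       & z = x t]].

Definition pball (R : realType) (m : nat) (p : \bar R) (l : R -> R) (s : R) :
    set 'cV[R]_m :=
  [set u | pnorm p u <= l s].

Definition support_fun (R : realType) (n : nat) (X : set 'cV[R]_n)
    (y : 'cV[R]_n) : R :=
  sup [set dot y x | x in X].

Definition cvec (R : realType) (n : nat) (A : 'M[R]_n) (t : R)
    (x0A x0B : 'cV[R]_n) : 'cV[R]_n :=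
  expm (t *: A) *m (x0A - x0B).

(* Here s is the time to go: an input applied at time t - s contributes to x(t)
   through exp(s A) B.  The input bounds are therefore evaluated at t - s; for
   constant bounds this is (lA + lB) exp(s A) B. *)
Definition Gmx (R : realType) (n m : nat) (A : 'M[R]_n) (B : 'M[R]_(n, m))
    (t : R) (lA lB : R -> R) (s : R) : 'M[R]_(n, m) :=
  (lA (t - s) + lB (t - s)) *: (expm (s *: A) *m B).

Definition sphere_values (R : realType) (n : nat) (XA XB : set 'cV[R]_n) :
    set R :=
  [set support_fun XA y + support_fun XB (- y) | y in
    [set y : 'cV[R]_n | norm2 y = 1]].

Definition ball_values (R : realType) (n m : nat) (q : \bar R) (t : R)
    (c : 'cV[R]_n) (G : R -> 'M[R]_(n, m)) : set R :=
  [set dot c y +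
       \int[lebesgue_measure]_(s in `[0, t]) pnorm q ((G s)^T *m y) | y in
    [set y : 'cV[R]_n | norm2 y <= 1]].

Definition trapezoid_weights (R : realType) (t : R) (K : nat) : 'cV[R]_K.+1 :=
  \col_k (t / K%:R * (if (k == 0 :> nat) || (k == K :> nat) then 2^-1 else 1)).

Definition trapezoid_values (R : realType) (n m : nat) (q : \bar R) (t : R)
    (c : 'cV[R]_n) (G : R -> 'M[R]_(n, m)) (K : nat) : set R :=
  [set v | exists (y : 'cV[R]_n) (theta : 'cV[R]_K.+1),
     [/\ forall k : 'I_K.+1,
           pnorm q ((G (k%:R * (t / K%:R)))^T *m y) <= theta k 0,
         forall k : 'I_K.+1, 0 <= theta k 0,
         norm2 y <= 1
       & v = dot c y + dot (trapezoid_weights t K) theta]].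

Definition is_minimum (R : realType) (S : set R) (v : R) : Prop :=
  S v /\ lbound S v.

(* Main.v *)
(* Write Phi(s) for exp((t - s)A)B. The values at t of the Caratheodory solutions
   are exp(tA)x0 + int_0^t Phi(s)u(s) ds: A is nilpotent, so existence follows
   by iterated integration and uniqueness by applying powers of A to the
   integral equation. Hoelder's inequality and piecewise constant controls give
   the support function of the reach set, whence
     h_A(y) + h_B(-y) = <c, y> + int_0^t |G(s)^T y|_q ds
   on the sphere. The right-hand side phi is positively homogeneous and
   Lipschitz; it has a minimum over the ball and over the sphere, and the two
   agree when the first is negative.
   The reach sets meet iff 0 belongs to the set c + int_0^t Phi u with
   |u|_p <= lA + lB, because such a u splits proportionally between the agents.
   Instead of weak compactness, a control minimising |c + int Phi u| is obtained
   from a minimising sequence that is Cauchy in L^2, hence (along the sequence)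
   almost everywhere convergent; if the minimal vector z is not 0, the
   variational inequality gives phi(-z/|z|) < 0. *)
Require Import Defs.
From HB Require Import structures.
From mathcomp Require Import all_boot all_order all_algebra.
From mathcomp Require Import all_classical all_reals all_analysis.
From mathcomp Require Import measurable_realfun.
From mathcomp Require Import ring lra.

Set Implicit Arguments.
Unset Strict Implicit.
Unset Printing Implicit Defensive.

Import Order.TTheory GRing.Theory Num.Theory.
Import numFieldNormedType.Exports.
Local Open Scope classical_set_scope.
Local Open Scope ring_scope.

(** * Inner product and p-norms *)

(** Support functions see only closed convex hulls, so nonnegativity on the sphere would by itself
    leave two reach sets at distance 0 that might not touch; a common point requires a control that
    attains the minimal norm. Many controls steer to the same vector, so a minimising sequence for
    the norm alone need not converge in any sense. The energy of the control is therefore minimised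
    as a second criterion, among near minimisers of the norm, and convexity then controls the
    distance between successive controls. Geometric rates give pointwise convergence directly, and
    pointwise limits preserve the constraint on the p-norm for every p, including 1 and infinity.
    The support function could be reached by selecting a Hoelder maximiser measurably in time; a
    supremum asks only for approximation, so maximisers are frozen on a fine grid. Two clocks occur:
    [Phi] runs in elapsed time and [G] in time to go, and the substitution of t - s for s connects
    them. *)

Section Dot.
Context (R : realType) (n : nat).
Implicit Types x y z : 'cV[R]_n.

Lemma dotC x y : dot x y = dot y x.
Proof. by apply: eq_bigr => i _; rewrite mulrC. Qed.

Lemma dotDr x y z : dot x (y + z) = dot x y + dot x z.
Proof. by rewrite /dot -big_split; apply: eq_bigr => i _; rewrite mxE mulrDr. Qed.

Lemma dotZr a x y : dot x (a *: y) = a * dot x y.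
Proof. by rewrite /dot mulr_sumr; apply: eq_bigr => i _; rewrite mxE mulrCA. Qed.

Lemma dotNr x y : dot x (- y) = - dot x y.
Proof. by rewrite -scaleN1r dotZr mulN1r. Qed.

Lemma dotDl x y z : dot (y + z) x = dot y x + dot z x.
Proof. by rewrite dotC dotDr !(dotC x). Qed.

Lemma dotZl a x y : dot (a *: y) x = a * dot y x.
Proof. by rewrite dotC dotZr (dotC x). Qed.

Lemma dotNl x y : dot (- y) x = - dot y x.
Proof. by rewrite dotC dotNr (dotC x). Qed.

Lemma dot0r x : dot x 0 = 0.
Proof. by rewrite -(scale0r 0) dotZr mul0r. Qed.

Lemma dot0l x : dot 0 x = 0.
Proof. by rewrite dotC dot0r. Qed.

Lemma dot_sqr_shift (a : R) x y :
  dot (x + a *: y) (x + a *: y) =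
  dot x x + 2 * (a * dot x y) + a * (a * dot y y).
Proof. by rewrite !(dotDl, dotDr) !(dotZl, dotZr) (dotC y x); ring. Qed.

Lemma dot_ge0 x : 0 <= dot x x.
Proof. by apply: sumr_ge0 => i _; rewrite -expr2 sqr_ge0. Qed.

Lemma dot_eq0 x : (dot x x == 0) = (x == 0).
Proof.
apply/idP/eqP => [|->]; last by rewrite dot0r.
rewrite psumr_eq0 => [/allP h|i _]; last by rewrite -expr2 sqr_ge0.
apply/colP => i; apply/eqP; rewrite mxE.
by have := h i (mem_index_enum _); rewrite mulf_eq0 orbb.
Qed.

Lemma dot_gt0 x : x != 0 -> 0 < dot x x.
Proof. by move=> x0; rewrite lt_neqAle dot_ge0 eq_sym dot_eq0 x0. Qed.

End Dot.

Lemma dot_mulmx (R : realType) (n m : nat) (M : 'M[R]_(n, m)) (y : 'cV[R]_n)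
    (u : 'cV[R]_m) :
  dot y (M *m u) = dot u (M^T *m y).
Proof.
rewrite /dot; under eq_bigr do rewrite mxE mulr_sumr.
rewrite exchange_big; apply: eq_bigr => j _; rewrite mxE mulr_sumr.
by apply: eq_bigr => i _; rewrite mxE; ring.
Qed.

Section Hoelder_conjugates.
Context (R : realType).

(** The three cases in which [pnorm] and the dual vectors have different formulas. In the finite
    case both exponents exceed 1, which keeps the exponent [b - 1] positive. *)
Variant hoelder_pair : \bar R -> \bar R -> Prop :=
| HoelderPair1y : hoelder_pair 1%:E +oo%E
| HoelderPairy1 : hoelder_pair +oo%E 1%:E
| HoelderPairFin a b of 1 < a & 1 < b & a^-1 + b^-1 = 1 :
    hoelder_pair a%:E b%:E.

(** In [\bar R] the inverse of 0 is [+oo] and that of [+oo] is 0. For finite exponents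
    [b^-1 = 1 - a^-1] is nonzero and nonnegative, which forces both [a] and [b] above 1. *)
Lemma hoelder_pairP (p q : \bar R) :
  (1 <= p)%E -> (p^-1 + q^-1 = 1)%E -> hoelder_pair p q.
Proof.
case: p => [a||] //.
- rewrite lee_fin => a1; rewrite inver gt_eqF ?(lt_le_trans ltr01)//.
  case: q => [b||].
  + rewrite inver; case: ifPn => // b0; rewrite -EFinD => -[ab].
    have a0 : 0 < a by rewrite (lt_le_trans ltr01).
    have ia1 : a^-1 <= 1 by rewrite invf_le1.
    have ib0 : 0 < b^-1.
      rewrite lt_neqAle eq_sym invr_eq0 b0 /=.
      by rewrite (_ : b^-1 = 1 - a^-1) ?subr_ge0 // -ab addrC addKr.
    have b0' : 0 < b by rewrite -invr_gt0.
    have ia0 : 0 < a^-1 by rewrite invr_gt0.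
    apply: HoelderPairFin => //.
    * by rewrite -invf_lt1// -ab ltrDl.
    * by rewrite -invf_lt1// -ab ltrDr.
  + rewrite invey adde0 => -[/eqP]; rewrite invr_eq1 => /eqP ->.
    exact: HoelderPair1y.
  + by rewrite inveNy.
- move=> _; rewrite invey add0e; case: q => [b||].
  + rewrite inver; case: ifPn => // b0 [/eqP]; rewrite invr_eq1 => /eqP ->.
    exact: HoelderPairy1.
  + by rewrite invey => -[/eqP]; rewrite eq_sym oner_eq0.
  + by [].
Qed.

Lemma hoelder_pair_sym (p q : \bar R) : hoelder_pair p q -> hoelder_pair q p.
Proof.
case=> [||a b a1 b1 ab].
- exact: HoelderPairy1.
- exact: HoelderPair1y.
- by apply: HoelderPairFin => //; rewrite addrC.
Qed.

End Hoelder_conjugates.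

Section Pnorm.
Context (R : realType) (n : nat).
Implicit Types x y u v : 'cV[R]_n.

Lemma pnorm_ge0 (p : \bar R) x : 0 <= pnorm p x.
Proof. by case: p => [a||] /=; rewrite ?powR_ge0 ?bigmax_ge_id. Qed.

Lemma pnorm1 x : pnorm 1%:E x = \sum_(i < n) `|x i 0|.
Proof.
rewrite /= invr1; under eq_bigr do rewrite powRr1//.
by rewrite powRr1// sumr_ge0.
Qed.

Lemma powR_pnorm (a : R) x : 0 < a ->
  pnorm a%:E x `^ a = \sum_(i < n) `|x i 0| `^ a.
Proof.
by move=> a0; rewrite /= -powRrM mulVf ?gt_eqF// powRr1// sumr_ge0.
Qed.

Lemma ler_coord_pnorm (p : \bar R) x i : (1 <= p)%E -> `|x i 0| <= pnorm p x.
Proof.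
case: p => [a||]//; last by move=> _; exact: le_bigmax.
rewrite lee_fin => a1; have a0 : 0 < a by rewrite (lt_le_trans ltr01).
rewrite -[leLHS]powRr1// -[X in _ `^ X](@mulfV _ a) ?gt_eqF// powRrM.
rewrite ge0_ler_powR ?nnegrE ?invr_ge0 ?powR_ge0 ?(ltW a0)//.
  by rewrite sumr_ge0.
by rewrite (bigD1 i)//= lerDl sumr_ge0.
Qed.

Lemma pnorm_eq0 (p : \bar R) x : (1 <= p)%E -> pnorm p x = 0 -> x = 0.
Proof.
move=> p1 x0; apply/colP => i; rewrite mxE; apply/eqP.
by rewrite -normr_le0 -x0; exact: ler_coord_pnorm.
Qed.

Lemma pnormZ (p : \bar R) (c : R) x : (1 <= p)%E ->
  pnorm p (c *: x) = `|c| * pnorm p x.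
Proof.
case: p => [a||]//=; last first.
  move=> _; rewrite (big_morph ( *%R `|c|) (id1 := 0) (op1 := Num.max)).
  - by apply: eq_bigr => i _; rewrite mxE normrM.
  - by move=> ? ?; rewrite maxr_pMr.
  - by rewrite mulr0.
rewrite lee_fin => a1; have a0 : 0 < a by rewrite (lt_le_trans ltr01).
under eq_bigr do rewrite mxE normrM powRM//.
rewrite -mulr_sumr powRM ?powR_ge0//; last first.
  by rewrite sumr_ge0.
by rewrite -powRrM mulfV ?gt_eqF// powRr1.
Qed.

Lemma pnorm0 (p : \bar R) : (1 <= p)%E -> pnorm p (0 : 'cV[R]_n) = 0.
Proof.
by move=> p1; rewrite -[X in pnorm _ X](scale0r (0 : 'cV[R]_n)) pnormZ// normr0 mul0r.
Qed.

Lemma hoelder_pair_ge1 (p q : \bar R) : hoelder_pair p q -> (1 <= p)%E.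
Proof. by case=> [||a b a1 _ _]; rewrite ?leey// lee_fin ltW. Qed.

Lemma dot_le_sum_norm u v : dot u v <= \sum_(i < n) `|u i 0| * `|v i 0|.
Proof. by apply: ler_sum => i _; rewrite -normrM ler_norm. Qed.

Lemma dot_le_pnormy u v : dot u v <= pnorm 1%:E u * pnorm +oo%E v.
Proof.
rewrite pnorm1 mulr_suml (le_trans (dot_le_sum_norm _ _))// ler_sum// => i _.
by rewrite ler_wpM2l//; exact: le_bigmax.
Qed.

(** In the finite case, Young's inequality is summed over coordinates normalised to unit norm, where
    the two sums contribute [a^-1 + b^-1 = 1]. Vectors of norm 0 are zero and are treated apart. *)
Lemma dot_le_pnorm (p q : \bar R) u v : hoelder_pair p q ->
  dot u v <= pnorm p u * pnorm q v.
Proof.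
case=> [||a b a1 b1 ab].
- exact: dot_le_pnormy.
- by rewrite dotC mulrC; exact: dot_le_pnormy.
have [a0 b0] : 0 < a /\ 0 < b by split; lra.
have sum_dot_le (S T : R) : 0 < S -> 0 < T ->
    \sum_(i < n) (`|u i 0| / S) `^ a = 1 ->
    \sum_(i < n) (`|v i 0| / T) `^ b = 1 -> dot u v <= S * T.
  move=> S0 T0 uS vT; apply: (le_trans (dot_le_sum_norm _ _)).
  have ST0 : 0 < S * T by exact: mulr_gt0.
  rewrite -[leRHS]mulr1 -(ler_pdivrMl _ _ ST0) mulr_sumr.
  apply: (@le_trans _ _ (\sum_(i < n)
    ((`|u i 0| / S) `^ a / a + (`|v i 0| / T) `^ b / b))).
    apply: ler_sum => i _.
    rewrite [leLHS](_ : _ = (`|u i 0| / S) * (`|v i 0| / T)); last first.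
      by rewrite invfM; ring.
    by apply: conjugate_powR => //; rewrite divr_ge0 ?(ltW S0) ?(ltW T0).
  by rewrite big_split /= -!mulr_suml uS vT !mul1r ab.
set S := pnorm a%:E u; set T := pnorm b%:E v.
have := pnorm_ge0 a%:E u; rewrite -/S le_eqVlt => /predU1P[S0|S0].
  by rewrite (@pnorm_eq0 a%:E u) ?lee_fin ?(ltW a1)// dot0l mulr_ge0 ?pnorm_ge0.
have := pnorm_ge0 b%:E v; rewrite -/T le_eqVlt => /predU1P[T0|T0].
  by rewrite (@pnorm_eq0 b%:E v) ?lee_fin ?(ltW b1)// dot0r mulr_ge0 ?pnorm_ge0.
have sum1 (c : R) (w : 'cV[R]_n) : 0 < c -> 0 < pnorm c%:E w ->
    \sum_(i < n) (`|w i 0| / pnorm c%:E w) `^ c = 1.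
  move=> c0 w0; under eq_bigr do rewrite powRM ?invr_ge0 ?(ltW w0)//.
  rewrite -mulr_suml -powR_pnorm// -powRM ?invr_ge0 ?(ltW w0)//.
  by rewrite mulfV ?gt_eqF// powR1.
have := sum_dot_le S T S0 T0 (sum1 _ _ a0 S0) (sum1 _ _ b0 T0).
exact.
Qed.

(** Extremal vectors: a signed unit vector at a largest coordinate for [q = +oo], the vector of
    signs for [q = 1], and otherwise signed powers [|v_i|^(b-1)] divided by [T^(b-1)]. *)
Lemma pnorm_dual (p q : \bar R) v : hoelder_pair p q ->
  exists2 u, pnorm p u <= 1 & dot u v = pnorm q v.
Proof.
move=> pq; have q1 := hoelder_pair_ge1 (hoelder_pair_sym pq).
have p1 := hoelder_pair_ge1 pq.
have [->|v0] := eqVneq v 0.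
  by exists 0; rewrite ?dot0r !pnorm0.
have [i0 vi0] : exists i, v i 0 != 0.
  apply: contrapT => /forallNP v0'; move/eqP: v0; apply; apply/colP => i.
  by rewrite mxE; apply/eqP/negPn/negP/v0'.
case: pq p1 q1 => [||a b a1 b1 ab] p1 q1.
- have [i _ vi] : {i | i \in predT & pnorm +oo%E v = `|v i 0|}.
    exact: (Order.TotalTheory.eq_bigmax i0).
  exists (\col_j (Num.sg (v i 0) *+ (j == i))).
    rewrite pnorm1 (bigD1 i)//= mxE eqxx mulr1n big1 ?addr0.
      by rewrite normr_sg lern1 leq_b1.
    by move=> j /negPf ji; rewrite mxE ji mulr0n normr0.
  rewrite /dot vi (bigD1 i)//= mxE eqxx mulr1n big1 ?addr0 -?normrEsg//.
  by move=> j /negPf ji; rewrite mxE ji mulr0n mul0r.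
- exists (\col_j Num.sg (v j 0)).
    by apply/bigmax_leP; split => // i _; rewrite mxE normr_sg lern1 leq_b1.
  by rewrite pnorm1; apply: eq_bigr => i _; rewrite mxE -normrEsg.
have [a0 b0] : 0 < a /\ 0 < b by split; lra.
set T := pnorm b%:E v; have T0 : 0 < T.
  by rewrite lt_neqAle pnorm_ge0 andbT eq_sym; apply: contra_neq v0; exact: pnorm_eq0.
pose w i := `|v i 0| `^ (b - 1) / T `^ (b - 1).
(* The sign is 0 where [v i 0 = 0], but there [w i] is 0 as well because [b - 1] is nonzero; a
   zeroth power of 0 would be 1. *)
have sw i : `|Num.sg (v i 0) * w i| = w i.
  rewrite normrM normr_sg (ger0_norm (_ : 0 <= w i)) ?divr_ge0 ?powR_ge0//.
  by have [vi|] := eqVneq (v i 0) 0; rewrite ?mul1r// /w vi normr0 powR0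
    ?mul0r// subr_eq0 gt_eqF.
exists (\col_i (Num.sg (v i 0) * w i)).
  (* Conjugacy in the form that turns the [a]-th powers of [w] into [|v_i|^b / T^b], whose sum is
     1. *)
  have ba : (b - 1) * a = b.
    have : a * b * (a^-1 + b^-1) = a * b by rewrite ab mulr1.
    by rewrite mulrDr mulrAC mulfV ?gt_eqF// mulfK ?gt_eqF//; lra.
  rewrite /= (_ : \sum_(i < n) _ = 1) ?powR1//.
  under eq_bigr do rewrite mxE sw /w powRM ?powR_ge0 ?invr_ge0 ?powR_ge0//.
  under eq_bigr do rewrite -powRN -(powRrM `|_|) -(powRrM T) mulNr ba.
  by rewrite -mulr_suml -powR_pnorm// -/T powRN mulfV// powR_eq0 (gt_eqF T0).
rewrite /dot; under eq_bigr => i _.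
  rewrite mxE mulrAC -normrEsg.
  rewrite /w mulrA (_ : `|_| * _ = `|v i 0| `^ b); last first.
    have [->|vi] := eqVneq (v i 0) 0; first by rewrite normr0 mul0r powR0// gt_eqF.
    rewrite -{1}[X in X * _]powRr1// -powRD ?subrKC//.
    by rewrite normr_eq0 vi implybT.
  over.
rewrite -mulr_suml -powR_pnorm// -/T -powRB ?(gt_eqF T0) ?implybT//.
by rewrite opprB subrKC powRr1// ltW.
Qed.

(** Minkowski's inequality by duality, with no case distinction on [p]: the dual vector of [x + y]
    is tested against [x] and [y] separately. *)
Lemma ler_pnormD (p q : \bar R) x y : hoelder_pair p q ->
  pnorm p (x + y) <= pnorm p x + pnorm p y.
Proof.
move=> /hoelder_pair_sym pq.
have [u u1 <-] := pnorm_dual (x + y) pq.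
rewrite dotDr lerD//; apply: (le_trans (dot_le_pnorm _ _ pq));
  by rewrite ler_piMl ?pnorm_ge0.
Qed.

Lemma pnorm_le_sum (p q : \bar R) x : hoelder_pair p q ->
  pnorm p x <= \sum_(i < n) `|x i 0|.
Proof.
move=> /hoelder_pair_sym pq; have [u u1 <-] := pnorm_dual x pq.
rewrite (le_trans (dot_le_sum_norm _ _))// ler_sum// => i _.
by rewrite ler_piMl// (le_trans _ u1)// ler_coord_pnorm//; apply: hoelder_pair_ge1 pq.
Qed.

(** The sum of absolute coordinates dominates every p-norm, so this one modulus serves all later
    continuity estimates. *)
Lemma pnorm_lip (p q : \bar R) x y : hoelder_pair p q ->
  `|pnorm p x - pnorm p y| <= \sum_(i < n) `|x i 0 - y i 0|.
Proof.
move=> pq.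
have h (u v : 'cV[R]_n) : pnorm p u - pnorm p v <= \sum_(i < n) `|u i 0 - v i 0|.
  rewrite lerBlDl -{1}(subrKC v u) (le_trans (ler_pnormD _ _ pq))// lerD2l.
  rewrite (le_trans (pnorm_le_sum _ pq))// ler_sum// => i _.
  by rewrite !mxE.
rewrite ler_norml h andbT lerNl opprB (le_trans (h _ _))// ler_sum// => i _.
by rewrite distrC.
Qed.

End Pnorm.


(** * Nilpotent matrices *)

Section Nilpotent.
Context (R : realType).

Lemma expr_Ablock (k e : nat) (i j : 'I_k) :
  (Ablock R k ^+ e) i j = ((i + e)%N == j :> nat)%:R.
Proof.
elim: e i => [|e ih] i; first by rewrite expr0 !mxE addn0.
rewrite exprS mxE; have [ik|ki] := ltnP i.+1 k.
  rewrite (bigD1 (Ordinal ik))//= mxE eqxx mul1r ih /= addSnnS big1 ?addr0//.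
  by move=> l /eqP li; rewrite mxE; case: eqP => [e0|]; rewrite ?mul0r//;
    case: li; apply: val_inj.
rewrite big1 => [|l _]; last first.
  by rewrite mxE (gtn_eqF (leq_trans (ltn_ord l) ki)) mul0r.
by rewrite gtn_eqF// (leq_trans (ltn_ord j))// addnS (leq_trans ki)// ltnS leq_addr.
Qed.

(** Acting on block columns keeps the induction to a single block product; with the block rows of
    the identity as [C], the power itself is recovered. *)
Lemma mxdiag_expr_mulmx (m : nat) (r : 'I_m -> nat) (B : forall j, 'M[R]_(r j))
    (k e : nat) (C : forall j, 'M[R]_(r j, k)) :
  (\mxdiag_j B j) ^+ e *m (\mxcol_j C j) = \mxcol_j (B j ^+ e *m C j).
Proof.
elim: e C => [|e ih] C.
  by rewrite expr0 mul1mx; apply: eq_mxcol => j; rewrite expr0 mul1mx.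
rewrite exprSr -mulmxA mul_mxdiag_mxcol ih; apply: eq_mxcol => j.
by rewrite exprSr mulmxA.
Qed.

(** A shift block of size [r j] vanishes at power [r j], and the total dimension dominates every
    block size. *)
Lemma Amx_nilpotent (m : nat) (r : 'I_m -> nat) :
  Amx R r ^+ (\sum_(j < m) r j) = 0.
Proof.
rewrite -[LHS]mulmx1 -(submxcolK 1%:M) mxdiag_expr_mulmx.
rewrite -[RHS](mxcol0 (p_ := r)); apply: eq_mxcol => j.
suff -> : Ablock R (r j) ^+ (\sum_(j < m) r j) = 0 by rewrite mul0mx.
apply/matrixP => a b; rewrite expr_Ablock mxE gtn_eqF//.
by rewrite (leq_trans (ltn_ord b))// (bigD1 j)//= addnCA leq_addr.
Qed.

(** The exponential series cut at [N]: for [A ^+ N = 0] it equals [expm (s *: A)], and its entries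
    are polynomials in [s]. *)
Definition exp_poly (n : nat) (A : 'M[R]_n) (N : nat) (s : R) : 'M[R]_n :=
  \sum_(k < N) (s ^+ k / k`!%:R) *: A ^+ k.

Lemma scalemx_expr (n : nat) (A : 'M[R]_n) (s : R) (k : nat) :
  (s *: A) ^+ k = s ^+ k *: A ^+ k.
Proof.
elim: k => [|k ih]; first by rewrite !expr0 scale1r.
by rewrite !exprS ih -[LHS]scalemxAl -scalemxAr scalerA.
Qed.

Lemma expm_nilpotent (n : nat) (A : 'M[R]_n) (N : nat) (s : R) :
  A ^+ N = 0 -> expm (s *: A) = exp_poly A N s.
Proof.
move=> AN; apply/matrixP => i j; rewrite mxE summxE; apply: cvg_lim => //.
(* The partial sums are constant from index [N] on. *)
apply: cvg_near_cst; exists N => // k /= Nk; rewrite /series /=.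
rewrite (big_cat_nat (n := N))//= [X in _ + X]big1_seq ?addr0; last first.
  move=> l /andP[_]; rewrite mem_index_iota => /andP[Nl _].
  have Al : A ^+ l = 0 by rewrite -(subnKC Nl) exprD AN mul0r.
  by rewrite scalemx_expr Al scaler0 mxE mulr0.
rewrite big_mkord; apply: eq_bigr => l _.
by rewrite scalemx_expr !mxE; ring.
Qed.

End Nilpotent.


(** * Componentwise integrals *)

Section Rintegral_extra.
Context d (T : measurableType d) (R : realType) (mu : {measure set T -> \bar R}).

Lemma integrable_fin_sum (D : set T) (I : Type) (s : seq I) (f : I -> T -> R) :
  measurable D -> (forall i, mu.-integrable D (EFin \o f i)) ->
  mu.-integrable D (EFin \o (fun x => \sum_(i <- s) f i x)).
Proof.
move=> mD fi; apply: (@eq_integrable _ _ _ _ _ mD (fun x => \sum_(i <- s) (f i x)%:E)%E).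
  by move=> x _ /=; rewrite sumEFin.
by apply: integrable_sum => // i _; exact: fi.
Qed.

Lemma integrable_finZ (D : set T) (a : R) (f : T -> R) :
  measurable D -> mu.-integrable D (EFin \o f) ->
  mu.-integrable D (EFin \o (fun x => a * f x)).
Proof.
move=> mD fi; apply: (@eq_integrable _ _ _ _ _ mD (fun x => a%:E * (f x)%:E)%E) => //.
exact: integrableZl.
Qed.

Lemma integrable_finD (D : set T) (f g : T -> R) : measurable D ->
  mu.-integrable D (EFin \o f) -> mu.-integrable D (EFin \o g) ->
  mu.-integrable D (EFin \o (fun x => f x + g x)).
Proof.
move=> mD fi gi; apply: (@eq_integrable _ _ _ _ _ mD (fun x => (f x)%:E + (g x)%:E)%E) => //.
exact: integrableD.
Qed.

Lemma Rintegral_sum (D : set T) (I : Type) (s : seq I) (f : I -> T -> R) :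
  measurable D -> (forall i, mu.-integrable D (EFin \o f i)) ->
  \int[mu]_(x in D) (\sum_(i <- s) f i x) =
  \sum_(i <- s) \int[mu]_(x in D) f i x.
Proof.
move=> mD fi; elim: s => [|i s ih].
  rewrite big_nil; under eq_Rintegral do rewrite big_nil.
  by rewrite Rintegral_cst ?mul0r.
rewrite big_cons; under eq_Rintegral do rewrite big_cons.
by rewrite RintegralD ?ih//; exact: integrable_fin_sum.
Qed.

End Rintegral_extra.

Section Vector_integral.
Context (R : realType).
Notation mu := (@lebesgue_measure R).

Definition vintegrable (n : nat) (D : set R) (f : R -> 'cV[R]_n) : Prop :=
  forall i, mu.-integrable D (EFin \o (fun s => f s i 0)).

Definition vint (n : nat) (D : set R) (f : R -> 'cV[R]_n) : 'cV[R]_n :=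
  \col_i \int[mu]_(s in D) f s i 0.

Variable D : set R.
Hypothesis mD : measurable D.

Lemma eq_vint n (f g : R -> 'cV[R]_n) :
  (forall s, D s -> f s = g s) -> vint D f = vint D g.
Proof.
move=> fg; apply/colP => i; rewrite !mxE; apply: eq_Rintegral => s /set_mem Ds.
by rewrite fg.
Qed.

Lemma eq_vintegrable n (f g : R -> 'cV[R]_n) :
  (forall s, D s -> f s = g s) -> vintegrable D f -> vintegrable D g.
Proof.
move=> fg fi i; apply: (@eq_integrable _ _ _ mu _ mD (EFin \o (fun s => f s i 0))).
  by move=> s /set_mem Ds /=; rewrite fg.
exact: fi.
Qed.

Lemma vintegrableD n (f g : R -> 'cV[R]_n) :
  vintegrable D f -> vintegrable D g -> vintegrable D (fun s => f s + g s).
Proof.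
move=> fi gi i; under eq_fun do rewrite mxE; exact: integrable_finD.
Qed.

Lemma vintegrable_sum n (I : Type) (r : seq I) (f : I -> R -> 'cV[R]_n) :
  (forall k, vintegrable D (f k)) ->
  vintegrable D (fun s => \sum_(k <- r) f k s).
Proof.
move=> fi i; under eq_fun do rewrite summxE.
by apply: integrable_fin_sum => // k; exact: fi.
Qed.

Lemma vintegrable_mulmx n m (M : 'M[R]_(n, m)) (f : R -> 'cV[R]_m) :
  vintegrable D f -> vintegrable D (fun s => M *m f s).
Proof.
move=> fi i; under eq_fun do rewrite mxE.
by apply: integrable_fin_sum => // k; apply: integrable_finZ => //; exact: fi.
Qed.

Lemma vintD n (f g : R -> 'cV[R]_n) :
  vintegrable D f -> vintegrable D g ->
  vint D (fun s => f s + g s) = vint D f + vint D g.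
Proof.
move=> fi gi; apply/colP => i; rewrite !mxE.
by under eq_Rintegral do rewrite mxE; rewrite RintegralD.
Qed.

Lemma vint_sum n (I : Type) (r : seq I) (f : I -> R -> 'cV[R]_n) :
  (forall k, vintegrable D (f k)) ->
  vint D (fun s => \sum_(k <- r) f k s) = \sum_(k <- r) vint D (f k).
Proof.
move=> fi; apply/colP => i; rewrite !mxE summxE.
under eq_Rintegral do rewrite summxE.
rewrite Rintegral_sum//; first by apply: eq_bigr => k _; rewrite mxE.
by move=> k; exact: fi.
Qed.

Lemma vint_mulmx n m (M : 'M[R]_(n, m)) (f : R -> 'cV[R]_m) :
  vintegrable D f -> vint D (fun s => M *m f s) = M *m vint D f.
Proof.
move=> fi; apply/colP => i; rewrite !mxE.
under eq_Rintegral do rewrite mxE.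
rewrite Rintegral_sum//; last by move=> k; apply: integrable_finZ => //; exact: fi.
by apply: eq_bigr => k _; rewrite mxE RintegralZl//; exact: fi.
Qed.

Lemma dot_vint n (y : 'cV[R]_n) (f : R -> 'cV[R]_n) :
  vintegrable D f -> dot y (vint D f) = \int[mu]_(s in D) dot y (f s).
Proof.
move=> fi; rewrite /dot Rintegral_sum//; last first.
  by move=> k; apply: integrable_finZ => //; exact: fi.
by apply: eq_bigr => k _; rewrite mxE RintegralZl//; exact: fi.
Qed.

End Vector_integral.

Section Bounded_measurable.
Context (R : realType).
Notation mu := (@lebesgue_measure R).

(** Unlike integrability, this class is closed under products, and on a compact interval it implies
    integrability. *)
Definition bounded_measurable (D : set R) (f : R -> R) : Prop :=
  measurable_fun D f /\ exists M, forall s, D s -> `|f s| <= M.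

Lemma bounded_measurable_integrable (a b : R) (f : R -> R) :
  bounded_measurable `[a, b] f -> mu.-integrable `[a, b] (EFin \o f).
Proof.
move=> [mf [M fM]]; apply: measurable_bounded_integrable => //.
  by rewrite [X in (X < _)%E]lebesgue_measure_itv/=; case: ifP => // _; rewrite ltey.
exists M; split; first exact: num_real.
by move=> x Mx s Ds; apply: le_trans (ltW Mx); exact: fM.
Qed.

Lemma Rintegral_cst_itv (a b c : R) : a <= b ->
  \int[mu]_(x in `[a, b]) c = c * (b - a).
Proof.
move=> ab; rewrite Rintegral_cst// [X in fine X]lebesgue_measure_itv /= lte_fin.
by move: ab; rewrite le_eqVlt => /predU1P[->|->] //; rewrite ltxx subrr.
Qed.

Lemma bounded_measurableD D (f g : R -> R) : measurable D ->
  bounded_measurable D f -> bounded_measurable D g ->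
  bounded_measurable D (fun s => f s + g s).
Proof.
move=> mD [mf [M fM]] [mg [N gN]]; split; first exact: measurable_funD.
exists (M + N) => s Ds; rewrite (le_trans (ler_normD _ _))// lerD//.
  exact: fM.
exact: gN.
Qed.

Lemma bounded_measurableM D (f g : R -> R) : measurable D ->
  bounded_measurable D f -> bounded_measurable D g ->
  bounded_measurable D (fun s => f s * g s).
Proof.
move=> mD [mf [M fM]] [mg [N gN]]; split; first exact: measurable_funM.
exists (M * N) => s Ds; rewrite normrM ler_pM//; [exact: fM|exact: gN].
Qed.

Lemma bounded_measurable_cst D (c : R) : bounded_measurable D (fun=> c).
Proof. by split; [exact: measurable_cst|exists `|c|]. Qed.

Lemma bounded_measurable_sum D (I : Type) (r : seq I) (f : I -> R -> R) :
  measurable D -> (forall i, bounded_measurable D (f i)) ->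
  bounded_measurable D (fun s => \sum_(i <- r) f i s).
Proof.
move=> mD fi; elim: r => [|i r ih].
  by under eq_fun do rewrite big_nil; exact: bounded_measurable_cst.
by under eq_fun do rewrite big_cons; exact: bounded_measurableD.
Qed.

Lemma within_continuous_bounded_measurable (a b : R) (f : R -> R) :
  {within `[a, b], continuous f} -> bounded_measurable `[a, b] f.
Proof.
move=> cf; split; first exact: subspace_continuous_measurable_fun.
have /compact_bounded [M [_ fM]] : compact (f @` `[a, b]).
  by apply: continuous_compact => //; exact: segment_compact.
exists (M + 1) => s Ds; apply: fM; first by rewrite ltrDl.
by exists s.
Qed.

Lemma continuous_bounded_measurable (a b : R) (f : R -> R) :
  continuous f -> bounded_measurable `[a, b] f.
Proof.
move=> cf; apply: within_continuous_bounded_measurable.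
exact: continuous_subspaceT.
Qed.

Lemma bounded_measurableS D E (f : R -> R) : measurable E -> D `<=` E ->
  bounded_measurable E f -> bounded_measurable D f.
Proof.
move=> mE DE [mf [M fM]]; split; first exact: measurable_funS mf.
by exists M => s /DE; exact: fM.
Qed.

End Bounded_measurable.


(** * Iterated integrals *)

Section Iterated_integral.
Context (R : realType).
Notation mu := (@lebesgue_measure R).

Definition divpow (k : nat) (x : R) : R := x ^+ k / k`!%:R.

Lemma continuous_divpow k : continuous (divpow k).
Proof.
by move=> x; apply: cvgM; [exact: exprn_continuous|exact: cvg_cst].
Qed.

Lemma continuous_divpow_shift k (s : R) : continuous (fun x => divpow k (x - s)).
Proof.
move=> x; apply: (@continuous_comp _ _ _ (fun x => x - s) (divpow k)).
  by apply: cvgB; [exact: cvg_id|exact: cvg_cst].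
exact: continuous_divpow.
Qed.

Lemma continuous_divpow_flip k (s : R) : continuous (fun x => divpow k (s - x)).
Proof.
move=> x; apply: (@continuous_comp _ _ _ (fun x => s - x) (divpow k)).
  by apply: cvgB; [exact: cvg_cst|exact: cvg_id].
exact: continuous_divpow.
Qed.

Lemma is_derive_divpow k (s x : R) :
  is_derive x (1 : R) (fun y => divpow k.+1 (y - s)) (divpow k (x - s)).
Proof.
pose g : R -> R := id - cst s.
have -> : (fun y => divpow k.+1 (y - s)) = (k.+1)`!%:R^-1 \*: (g ^+ k.+1).
  by apply/funext => y; rewrite /divpow mulrC exprfctE.
have dg : is_derive x (1 : R) g 1.
  by rewrite -[X in is_derive _ _ _ X]subr0; exact: is_deriveB.
apply: (is_derive_eq (is_deriveZ _ (is_deriveX k.+1 dg))).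
rewrite /divpow factS natrM invfM /GRing.scale /= mulr1 mulrACA.
by rewrite mulVf ?pnatr_eq0// mul1r mulrC.
Qed.

Lemma Rintegral_divpow k (s tau : R) : s <= tau ->
  \int[mu]_(x in `[s, tau]) divpow k (x - s) = divpow k.+1 (tau - s).
Proof.
rewrite le_eqVlt => /predU1P[->|st].
  by rewrite set_itv1 Rintegral_set1 subrr /divpow expr0n mul0r.
have dF x : derivable (fun y => divpow k.+1 (y - s)) x 1 by have [] := is_derive_divpow k s x.
have cF x : {for x, continuous (fun y => divpow k.+1 (y - s))}.
  exact/differentiable_continuous/derivable1_diffP.
rewrite /Rintegral (continuous_FTC2 st (F := fun y => divpow k.+1 (y - s))).
- by rewrite -EFinB /= subrr {2}/divpow expr0n mul0r subr0.
- exact/continuous_subspaceT/continuous_divpow_shift.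
- split => //.
  + exact/cvg_at_right_filter/cF.
  + exact/cvg_at_left_filter/cF.
- by move=> x _; rewrite derive1E; have [_ ->] := is_derive_divpow k s x.
Qed.

(** Cauchy's formula for repeated integration: the [k.+1]-fold primitive of [f] vanishing at 0. *)
Definition divpow_int (k : nat) (f : R -> R) (tau : R) : R :=
  \int[mu]_(s in `[0, tau]) (divpow k (tau - s) * f s).

Variables (t : R) (f : R -> R).
Hypothesis bf : bounded_measurable `[0, t] f.

Let le_itv tau : tau <= t -> `[0, tau] `<=` `[0, t].
Proof. by move=> tt; apply: subset_itvl; rewrite bnd_simp. Qed.

Lemma bounded_measurable_divpow k tau : tau <= t ->
  bounded_measurable `[0, tau] (fun s => divpow k (tau - s) * f s).
Proof.
move=> tt; apply: bounded_measurableM => //.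
  exact/continuous_bounded_measurable/continuous_divpow_flip.
exact: bounded_measurableS (le_itv tt) bf.
Qed.

Let triangle (tau : R) : set (R * R) :=
  [set z | 0 <= z.2 /\ z.2 <= z.1 /\ z.1 <= tau].

Let measurable_triangle tau : measurable (triangle tau).
Proof.
have mle (g h : R * R -> R) : measurable_fun setT g -> measurable_fun setT h ->
    measurable [set z | g z <= h z].
  move=> mg mh; have := measurable_fun_ler mg mh measurableT (Y := [set true]) I.
  by rewrite setTI.
rewrite (_ : triangle tau = [set z | 0 <= z.2] `&`
  ([set z | z.2 <= z.1] `&` [set z | z.1 <= tau]))//.
apply: measurableI; last apply: measurableI; apply: mle.
- exact: measurable_cst.
- exact: measurable_snd.
- exact: measurable_snd.
- exact: measurable_fst.
- exact: measurable_fst.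
- exact: measurable_cst.
Qed.

Let h (k : nat) (z : R * R) : R := divpow k (z.1 - z.2) * f z.2.

Let integrable_triangle k tau : tau <= t ->
  (mu \x mu)%E.-integrable (triangle tau) (EFin \o h k).
Proof.
move=> tt; have [mf [M fM]] := bf.
have snd_triangle z : triangle tau z -> `[0, t]%classic z.2.
  by move=> [z2 [z21 z1]]; rewrite /= in_itv /= z2 (le_trans z21)// (le_trans z1).
apply: measurable_bounded_integrable => //.
- exact: measurable_triangle.
- apply: (@le_lt_trans _ _ ((mu \x mu)%E (`[0, tau] `*` `[0, tau]))).
    apply: le_measure.
    - by rewrite inE; exact: measurable_triangle.
    - by rewrite inE; exact: measurableX.
    move=> z [z2 [z21 z1]]; split; rewrite /= in_itv /= ?z1 ?z2 ?andbT//=.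
      exact: le_trans z21.
    exact: le_trans z1.
  rewrite product_measure1E//= !lebesgue_measure_itv /=.
  by case: ifP => _; rewrite ?mul0e ?ltry// -EFinD -EFinM ltry.
- apply: measurable_funM; last first.
    apply: (measurable_comp (F := `[0, t]%classic)) => //.
    + by move=> _ [z /snd_triangle ? <-].
    + exact: measurable_funTS measurable_snd.
  apply: measurable_funM; last exact: measurable_cst.
  apply: measurable_funX; apply: measurable_funB.
    exact: measurable_funTS measurable_fst.
  exact: measurable_funTS measurable_snd.
(* On the triangle [0 <= z.1 - z.2 <= tau], so the kernel is at most [divpow k tau]. *)
- exists (divpow k tau * M); split; first exact: num_real.
  move=> x Mx z Tz; apply: le_trans (ltW Mx); rewrite /= normrM.
  have ft := fM _ (snd_triangle _ Tz); case: Tz => z2 [z21 z1].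
  apply: ler_pM => //; rewrite ger0_norm ?divr_ge0 ?exprn_ge0 ?subr_ge0//.
  rewrite ler_wpM2r ?invr_ge0// lerXn2r ?nnegrE ?subr_ge0//.
    exact: le_trans (le_trans z2 z21) z1.
  by rewrite (le_trans _ z1)// gerBl.
Qed.

(* By Fubini's theorem on the triangle 0 <= s <= sigma <= tau. *)
Lemma Rintegral_divpow_int k tau : 0 <= tau <= t ->
  mu.-integrable `[0, tau] (EFin \o divpow_int k f) ->
  \int[mu]_(sigma in `[0, tau]) divpow_int k f sigma = divpow_int k.+1 f tau.
Proof.
move=> /andP[tau0 tt] iJ.
set hT := (EFin \o h k) \_ (triangle tau).
have /Fubini FT : (mu \x mu)%E.-integrable setT hT.
  refine (iffLR (integrable_mkcond _ _) (integrable_triangle k tt)).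
  exact: measurable_triangle.
(* Sections of the triangle: for fixed sigma = x the variable s runs over [0, x], and for fixed s =
   y the variable sigma runs over [y, tau]. Outside [0, tau] the sections are empty. *)
have hT1 (x : R) : `[0, tau]%classic x ->
    (\int[mu]_y hT (x, y) = \int[mu]_(y in `[0%R, x]) (h k (x, y))%:E)%E.
  rewrite /= in_itv /= => /andP[x0 xt].
  rewrite [RHS]integral_mkcond; apply: eq_integral => y _.
  rewrite /hT /patch; congr (if _ then _ else _).
  apply/idP/idP; rewrite !inE /= in_itv /=.
    by move=> [y0 [yx _]]; rewrite y0 yx.
  by move=> /andP[y0 yx]; split.
have hT1' (x : R) : ~ `[0, tau]%classic x -> (\int[mu]_y hT (x, y) = 0)%E.
  move=> xt; rewrite (eq_integral (cst 0%E)) ?integral0// => y _.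
  rewrite /hT /patch; case: ifPn => //; rewrite inE /= => -[y0 [yx xt']].
  by case: xt; rewrite /= in_itv /= xt' (le_trans y0 yx).
have hT2 (y : R) : `[0, tau]%classic y ->
    (\int[mu]_x hT (x, y) = \int[mu]_(x in `[y, tau]) (h k (x, y))%:E)%E.
  rewrite /= in_itv /= => /andP[y0 yt].
  rewrite [RHS]integral_mkcond; apply: eq_integral => x _.
  rewrite /hT /patch; congr (if _ then _ else _).
  apply/idP/idP; rewrite !inE /= in_itv /=.
    by move=> [_ [yx xt]]; rewrite xt yx.
  by move=> /andP[yx xt]; split.
have hT2' (y : R) : ~ `[0, tau]%classic y -> (\int[mu]_x hT (x, y) = 0)%E.
  move=> yt; rewrite (eq_integral (cst 0%E)) ?integral0// => x _.
  rewrite /hT /patch; case: ifPn => //; rewrite inE /= => -[y0 [yx xt']].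
  by case: yt; rewrite /= in_itv /= y0 (le_trans yx xt').
rewrite /Rintegral /divpow_int /Rintegral; congr fine.
transitivity (\int[mu]_x \int[mu]_y hT (x, y))%E.
  rewrite integral_mkcond; apply: eq_integral => x _; rewrite /patch.
  case: ifPn => [/set_mem xt|/negP xt]; last first.
    by rewrite hT1'// => xt'; apply: xt; rewrite inE.
  rewrite hT1// fineK//; apply: integrable_fin_num => //.
  apply: bounded_measurable_integrable; apply: bounded_measurable_divpow.
  by move: xt; rewrite /= in_itv /= => /andP[_ xt]; exact: le_trans tt.
rewrite FT [RHS]integral_mkcond; apply: eq_integral => y _; rewrite /patch.
case: ifPn => [/set_mem yt|/negP yt]; last first.
  by rewrite hT2'// => yt'; apply: yt; rewrite inE.
rewrite hT2//.
have ck : {within `[y, tau], continuous (fun x => divpow k (x - y))}.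
  exact/continuous_subspaceT/continuous_divpow_shift.
have ik : mu.-integrable `[y, tau] (EFin \o (fun x => divpow k (x - y))).
  exact/bounded_measurable_integrable/within_continuous_bounded_measurable.
move: yt; rewrite /= in_itv /= => /andP[y0 yt].
under eq_integral do rewrite /h /= mulrC EFinM.
rewrite integralZl// -Rintegral_divpow// /Rintegral EFinM muleC fineK//.
exact: integrable_fin_num.
Qed.

(** Each iterated integral is a primitive of the preceding one, and a primitive is continuous. *)
Lemma continuous_divpow_int k : 0 <= t -> {within `[0, t], continuous (divpow_int k f)}.
Proof.
move=> t0; elim: k => [|k ih].
  have <- : (fun tau => \int[mu]_(s in `[0, tau]) f s) = divpow_int 0 f.
    apply/funext => tau; apply: eq_Rintegral => s _.
    by rewrite /divpow expr0 fact0 divr1 mul1r.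
  exact/parameterized_integral_continuous/bounded_measurable_integrable.
have iJ : mu.-integrable `[0, t] (EFin \o divpow_int k f).
  exact/bounded_measurable_integrable/within_continuous_bounded_measurable.
have := parameterized_integral_continuous t0 iJ.
apply: subspace_eq_continuous => tau.
rewrite inE /= in_itv /= => /andP[tau0 tt].
apply: Rintegral_divpow_int; first by rewrite tau0.
by apply: integrableS iJ => //; exact: le_itv.
Qed.

End Iterated_integral.


(** * Variation of constants *)

Section Within_continuous.
Context (R : realType) (D : set R).

Lemma within_continuousD (f g : R -> R) : {within D, continuous f} ->
  {within D, continuous g} -> {within D, continuous (fun s => f s + g s)}.
Proof. by move=> cf cg s; apply: cvgD; [exact: cf|exact: cg]. Qed.

Lemma within_continuousZ (a : R) (f : R -> R) : {within D, continuous f} ->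
  {within D, continuous (fun s => a * f s)}.
Proof. by move=> cf s; apply: cvgM; [exact: cvg_cst|exact: cf]. Qed.

Lemma within_continuous_sum (I : Type) (r : seq I) (f : I -> R -> R) :
  (forall i, {within D, continuous (f i)}) ->
  {within D, continuous (fun s => \sum_(i <- r) f i s)}.
Proof.
move=> cf; elim: r => [|i r ih].
  by under eq_fun do rewrite big_nil; move=> s; exact: cvg_cst.
by under eq_fun do rewrite big_cons; exact: within_continuousD.
Qed.

End Within_continuous.

Section Variation_of_constants.
Context (R : realType) (n m N : nat) (A : 'M[R]_n) (B : 'M[R]_(n, m)).
Context (t : R) (x0 : 'cV[R]_n) (u : R -> 'cV[R]_m).
Hypothesis AN : A ^+ N = 0.
Hypothesis t0 : 0 <= t.
Hypothesis bu : forall j, bounded_measurable `[0, t] (fun s => u s j 0).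
Notation mu := (@lebesgue_measure R).

Let bBu l : bounded_measurable `[0, t] (fun s => (B *m u s) l 0).
Proof.
have -> : (fun s => (B *m u s) l 0) = (fun s => \sum_j B l j * u s j 0).
  by apply/funext => s; rewrite mxE.
apply: bounded_measurable_sum => // j.
by apply: bounded_measurableM => //; exact: bounded_measurable_cst.
Qed.

Let itvS (tau : R) : 0 <= tau <= t -> `[0, tau]%classic `<=` `[0, t]%classic.
Proof. by move=> /andP[_ tt]; apply: subset_itvl; rewrite bnd_simp. Qed.

Let iBu tau : 0 <= tau <= t -> vintegrable `[0, tau] (fun s => B *m u s).
Proof.
move=> tt l; apply: bounded_measurable_integrable.
exact: bounded_measurableS (itvS tt) (bBu l).
Qed.

(** The terms of the Picard series, without the powers of [A]: [ivec k.+1] is the primitive of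
    [ivec k] vanishing at 0. *)
Let ivec (k : nat) (tau : R) : 'cV[R]_n :=
  divpow k tau *: x0 + \col_l divpow_int k (fun s => (B *m u s) l 0) tau.

Let continuous_ivec k l : {within `[0, t], continuous (fun s => ivec k s l 0)}.
Proof.
rewrite (_ : (fun s => _) = (fun s => x0 l 0 * divpow k s +
    divpow_int k (fun s => (B *m u s) l 0) s)); last first.
  by apply/funext => s; rewrite !mxE mulrC.
apply: within_continuousD.
  apply: within_continuousZ.
  exact/continuous_subspaceT/continuous_divpow.
exact: continuous_divpow_int.
Qed.

Let integrable_within (f : R -> R) tau : 0 <= tau <= t ->
  {within `[0, t], continuous f} -> mu.-integrable `[0, tau] (EFin \o f).
Proof.
move=> tt cf; apply: bounded_measurable_integrable.
apply: bounded_measurableS (itvS tt) _ => //.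
exact: within_continuous_bounded_measurable.
Qed.

Let integrable_ivec k tau : 0 <= tau <= t -> vintegrable `[0, tau] (ivec k).
Proof. by move=> tt l; exact: (integrable_within tt (continuous_ivec (k:=k) (l:=l))). Qed.

Let vint_ivec k tau : 0 <= tau <= t -> vint `[0, tau] (ivec k) = ivec k.+1 tau.
Proof.
move=> tt; have /andP[tau0 _] := tt; apply/colP => l; rewrite !mxE.
have cJ := continuous_divpow_int (bBu l) t0 (k:=k).
under eq_Rintegral do rewrite !mxE mulrC.
have ck : {within `[0, t], continuous (divpow k : R -> R)}.
  exact/continuous_subspaceT/continuous_divpow.
rewrite RintegralD//; last 2 first.
- by apply: (integrable_within tt); exact: within_continuousZ.
- exact: (integrable_within tt).
rewrite RintegralZl//; last exact: (integrable_within tt).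
rewrite (Rintegral_divpow_int (bBu l))//; last exact: (integrable_within tt).
have := Rintegral_divpow k tau0; rewrite subr0 => <-.
by rewrite mulrC; congr (_ * _ + _); apply: eq_Rintegral => s _; rewrite subr0.
Qed.

(** The Picard series terminates. Integrating [A *m x] shifts it by one term; the term with [A ^+ N]
    vanishes, and [x0] plus the integral of [B *m u] supplies the term of index 0. *)
Lemma solution_exists : exists x, is_solution A B t x0 u x /\
  x t = exp_poly A N t *m x0 +
        vint `[0, t] (fun s => exp_poly A N (t - s) *m B *m u s).
Proof.
pose x tau := \sum_(k < N) A ^+ k *m ivec k tau.
have xE tau : 0 <= tau <= t ->
    x tau = x0 + vint `[0, tau] (fun s => A *m x s + B *m u s).
  move=> tt; rewrite vintD//; [| |exact: iBu]; last first.
    apply: vintegrable_mulmx => //; apply: vintegrable_sum => // k.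
    by apply: vintegrable_mulmx => //; exact: integrable_ivec.
  have -> : vint `[0, tau] (fun s => B *m u s) = ivec 0 tau - x0.
    apply/colP => l; rewrite !mxE {1}/divpow expr0 fact0 divr1 mul1r addrAC subrr add0r.
    apply: eq_Rintegral => s _.
    by rewrite /divpow expr0 fact0 divr1 mul1r.
  have -> : vint `[0, tau] (fun s => A *m x s) =
      \sum_(k < N) A ^+ k.+1 *m ivec k.+1 tau.
    rewrite (@eq_vint _ _ _ _ (fun s => \sum_(k < N) A ^+ k.+1 *m ivec k s)).
      rewrite vint_sum//; last first.
        by move=> k; apply: vintegrable_mulmx => //; exact: integrable_ivec.
      apply: eq_bigr => k _; rewrite vint_mulmx ?vint_ivec//.
      exact: integrable_ivec.
    move=> s _; rewrite /x mulmx_sumr; apply: eq_bigr => k _.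
    by rewrite exprS mulmxA.
  rewrite addrCA subrKC.
  transitivity (\sum_(k < N.+1) A ^+ k *m ivec k tau).
    by rewrite big_ord_recr /= AN mul0mx addr0.
  by rewrite big_ord_recl expr0 mul1mx addrC.
exists x; split.
  move=> i; split; last by move=> tau tt; rewrite xE// !mxE.
  rewrite (_ : (fun s => _) = (fun s => \sum_(k < N) \sum_l
      (A ^+ k) i l * ivec k s l 0)); last first.
    by apply/funext => s; rewrite summxE; apply: eq_bigr => k _; rewrite mxE.
  apply: within_continuous_sum => k.
  by apply: within_continuous_sum => l; exact: within_continuousZ.
(* At time [t] the kernels [divpow k (t - s)], weighted by [A ^+ k], add up to the exponential under
   the integral. *)
rewrite /x /exp_poly mulmx_suml.
rewrite [vint _ _](@eq_vint _ _ _ _ (fun s =>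
    \sum_(k < N) A ^+ k *m (divpow k (t - s) *: (B *m u s)))); last first.
  move=> s _; rewrite !mulmx_suml; apply: eq_bigr => k _.
  by rewrite -scalemxAr -!scalemxAl mulmxA.
have ik k : vintegrable `[0, t] (fun s => divpow k (t - s) *: (B *m u s)).
  move=> l; rewrite (_ : (fun s => _) =
      (fun s => divpow k (t - s) * (B *m u s) l 0)); last first.
    by apply/funext => s; rewrite mxE.
  exact/bounded_measurable_integrable/bounded_measurable_divpow.
rewrite vint_sum//; last by move=> k; exact: vintegrable_mulmx.
rewrite -big_split; apply: eq_bigr => k _.
rewrite vint_mulmx//= -scalemxAl scalemxAr -mulmxDr; congr (_ *m (_ + _)).
by apply/colP => l; rewrite !mxE; apply: eq_Rintegral => s _; rewrite [RHS]mxE.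
Qed.

(** Nilpotency replaces Gronwall's inequality: the difference [w] is [A] times its own integral, so
    if [A ^+ j.+1 *m w] vanishes on the interval, then so does [A ^+ j *m w]. The descent starts at
    [A ^+ N = 0]. *)
Lemma solution_unique (x y : R -> 'cV[R]_n) :
  is_solution A B t x0 u x -> is_solution A B t x0 u y -> x t = y t.
Proof.
move=> xs ys; pose w s := x s - y s.
have cs z : is_solution A B t x0 u z -> forall tau, 0 <= tau <= t ->
    vintegrable `[0, tau] z.
  by move=> zs tau tt l; have [cz _] := zs l; exact: integrable_within cz.
have iw tau : 0 <= tau <= t -> vintegrable `[0, tau] w.
  move=> tt; apply: (@eq_vintegrable _ _ _ _ (fun s => x s + (-1)%:M *m y s)) => //.
    by move=> s _; rewrite mul_scalar_mx scaleN1r.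
  by apply: vintegrableD => //; [|apply: vintegrable_mulmx => //]; exact: cs.
have sE z : is_solution A B t x0 u z -> forall tau, 0 <= tau <= t ->
    z tau = x0 + (A *m vint `[0, tau] z + vint `[0, tau] (fun s => B *m u s)).
  move=> zs tau tt; rewrite -vint_mulmx//; last exact: cs.
  rewrite -vintD//; [| |exact: iBu]; last first.
    by apply: vintegrable_mulmx => //; exact: cs.
  by apply/colP => l; have [_ ->] := zs l; rewrite // !mxE.
have wE tau : 0 <= tau <= t -> w tau = A *m vint `[0, tau] w.
  move=> tt; have -> : vint `[0, tau] w = vint `[0, tau] x - vint `[0, tau] y.
    rewrite -[X in _ = _ + X]scaleN1r -mul_scalar_mx -vint_mulmx//; last exact: cs.
    rewrite -vintD//; [|exact: cs|]; last first.
      by apply: vintegrable_mulmx => //; exact: cs.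
    by apply: eq_vint => s _; rewrite mul_scalar_mx scaleN1r.
  rewrite /w (sE _ xs)// (sE _ ys)// mulmxBr.
  by rewrite opprD addrACA subrr add0r opprD addrACA subrr addr0.
have Aw k tau : (k <= N)%N -> 0 <= tau <= t -> A ^+ (N - k) *m w tau = 0.
  elim: k tau => [|k ih] tau kN tt; first by rewrite subn0 AN mul0mx.
  rewrite wE// mulmxA (_ : _ *m A = A ^+ (N - k)); last first.
    by rewrite -(subnSK kN) exprSr.
  rewrite -vint_mulmx//; last exact: iw.
  rewrite (@eq_vint _ _ _ _ (fun=> 0)).
    apply/colP => l; rewrite !mxE -[RHS](mul0r (fine (mu `[0, tau]))).
    by rewrite -Rintegral_cst//; apply: eq_Rintegral => s _; rewrite mxE.
  move=> s; rewrite /= in_itv /= => /andP[s0 st]; apply: ih; first exact: ltnW.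
  by have /andP[_ tt'] := tt; rewrite s0 (le_trans st).
apply/eqP; rewrite -subr_eq0; apply/eqP.
by have := Aw N t (leqnn N); rewrite subnn expr0 mul1mx; apply; rewrite lexx t0.
Qed.

End Variation_of_constants.

(** The uniform bound on the input sets makes every selected input bounded, so the integrals are
    genuine and not default values. Existence supplies a solution with the stated end point, and
    uniqueness identifies any other solution with it at time [t]. *)
Lemma reach_setE (R : realType) (n m N : nat) (A : 'M[R]_n) (B : 'M[R]_(n, m))
    (t : R) (x0 : 'cV[R]_n) (U : R -> set 'cV[R]_m) :
  A ^+ N = 0 -> 0 <= t ->
  (exists M, forall s v j, 0 <= s <= t -> U s v -> `|v j 0| <= M) ->
  reach_set A B t x0 U =
  [set z | exists u : R -> 'cV[R]_m,
    [/\ forall j, measurable_fun `[0, t] (fun s => u s j 0),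
        forall s, 0 <= s <= t -> U s (u s)
      & z = exp_poly A N t *m x0 +
            vint `[0, t] (fun s => exp_poly A N (t - s) *m B *m u s)]].
Proof.
move=> AN t0 [M UM]; apply/seteqP; split => z /=.
  move=> [u [x [mu uU xs ->]]]; exists u; split => //.
  have bu j : bounded_measurable `[0, t] (fun s => u s j 0).
    split; first exact: mu.
    by exists M => s; rewrite /= in_itv /= => st; exact: UM (uU _ st).
  have [y [ys <-]] := solution_exists B x0 AN t0 bu.
  exact: (solution_unique AN t0 bu xs ys).
move=> [u [mu uU ->]].
have bu j : bounded_measurable `[0, t] (fun s => u s j 0).
  split; first exact: mu.
  by exists M => s; rewrite /= in_itv /= => st; exact: UM (uU _ st).
have [y [ys <-]] := solution_exists B x0 AN t0 bu.
by exists u, y.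
Qed.


(** * Uniform continuity *)

Section Uniform_continuity.
Context (R : realType).

Lemma continuous_sum (T : topologicalType) (I : Type) (r : seq I)
    (f : I -> T -> R) :
  (forall i, continuous (f i)) -> continuous (fun s => \sum_(i <- r) f i s).
Proof.
move=> cf; elim: r => [|i r ih].
  by under eq_fun do rewrite big_nil; move=> s; exact: cvg_cst.
by under eq_fun do rewrite big_cons; move=> s; apply: cvgD; [exact: cf|exact: ih].
Qed.

(** Only [x] is confined to the interval, so applications need not locate [y]. The local radius is
    halved so that a point close to a neighbour of the centre is still close to the centre. *)
Lemma uniform_continuous_itv (a b : R) (f : R -> R) (e : R) :
  continuous f -> 0 < e ->
  \forall d \near 0^'+, forall x y : R, a <= x <= b -> `|x - y| < d ->
    `|f x - f y| < e.
Proof.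
move=> cf e0; pose P (d x : R) := forall y : R, `|x - y| < d -> `|f x - f y| < e.
have /compact_near_coveringP/(_ R 0^'+ P) : compact `[a, b]%classic.
  exact: segment_compact.
have near_P : forall x, `[a, b]%classic x -> \forall x' \near x & d \near 0^'+, P d x'.
  move=> x _; have e20 : 0 < e / 2 by rewrite divr_gt0.
  have /cvgr_dist_lt/(_ _ e20) /nbhs_ballP [r /= r0 rP] := cf x.
  have r20 : 0 < r / 2 by rewrite divr_gt0.
  exists (ball x (r / 2), [set d | d < r / 2]) => /=.
    by split; [exact: nbhsx_ballx|exact: nbhs_right_lt].
  move=> [z d] /= [xz dr] y zy.
  have xz' : `|x - z| < r by rewrite (lt_trans xz)// ltr_pdivrMr// ltr_pMr// ltr1n.
  have xy : `|x - y| < r.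
    by rewrite (splitr r) (le_lt_trans (ler_distD z _ _))// ltrD// (lt_trans zy).
  have fxz := rP _ xz'; have fxy := rP _ xy.
  rewrite (splitr e) (le_lt_trans (ler_distD (f x) _ _))// ltrD//.
  by rewrite distrC.
move=> /(_ _ near_P); apply: filterS => d dP x y xab; apply: dP.
by rewrite /= in_itv.
Qed.

Context (n m : nat) (G : R -> 'M[R]_(n, m)).
Hypothesis cG : forall i j, continuous (fun s => G s i j).

(** The same [d] serves every [y] of the ball, whose coordinates are at most 1 in absolute value;
    this later makes the trapezoidal error uniform in [y]. *)
Lemma uniform_continuous_mulmx (t e : R) : 0 < e -> exists2 d, 0 < d &
  forall s s' : R, 0 <= s <= t -> `|s - s'| < d ->
  forall y : 'cV[R]_n, norm2 y <= 1 ->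
    \sum_j `|((G s)^T *m y) j 0 - ((G s')^T *m y) j 0| <= e.
Proof.
(* There are [m * n] entries, each allowed an error [e / C]; the added 1 keeps [C] positive when a
   dimension is 0. *)
move=> e0; set C : R := m%:R * n%:R + 1.
have C0 : 0 < C by rewrite ltr_wpDl// mulr_ge0.
have eC0 : 0 < e / C by rewrite divr_gt0.
have : \forall d \near 0^'+, forall ij : 'I_n * 'I_m, forall x y : R,
    0 <= x <= t -> `|x - y| < d -> `|G x ij.1 ij.2 - G y ij.1 ij.2| < e / C.
  apply: filter_forall => -[i j]; exact: uniform_continuous_itv.
move=> dP; have [d [d0 dP']] : exists d, 0 < d /\ forall ij : 'I_n * 'I_m,
    forall x y : R, 0 <= x <= t -> `|x - y| < d ->
    `|G x ij.1 ij.2 - G y ij.1 ij.2| < e / C.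
  apply/(@filter_ex _ (0 : R)^'+); near=> d; split; first by near: d; exact: nbhs_right_gt.
  by near: d.
exists d => // s s' st ss' y y1.
have yi i : `|y i 0| <= 1.
  rewrite -[leRHS](ger0_norm ler01) -ler_sqr ?nnegrE// -[leLHS]normrX -[leRHS]normrX.
  move: y1; rewrite /norm2 -[X in _ <= X -> _]sqrtr1 ler_sqrt// => y1.
  rewrite !ger0_norm ?sqr_ge0// expr1n (le_trans _ y1)// /dot (bigD1 i)//= -expr2.
  by rewrite lerDl sumr_ge0// => k _; rewrite -expr2 sqr_ge0.
apply: (@le_trans _ _ (\sum_(j < m) \sum_(i < n) (e / C))); last first.
  rewrite !sumr_const !card_ord -mulrnA -mulr_natl natrM mulrA ler_pdivrMr//.
  by rewrite mulrC ler_wpM2l ?(ltW e0)// /C [n%:R * _]mulrC lerDl.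
apply: ler_sum => j _; rewrite !mxE -sumrB (le_trans (ler_norm_sum _ _ _))//.
apply: ler_sum => i _; rewrite !mxE -mulrBl normrM.
rewrite -[leRHS]mulr1; apply: ler_pM => //.
by rewrite ltW//; exact: (dP' (i, j)).
Unshelve. all: by end_near. Qed.

Lemma continuous_pnorm_mulmx (p q : \bar R) (y : 'cV[R]_n) :
  hoelder_pair p q -> continuous (fun s => pnorm p ((G s)^T *m y)).
Proof.
move=> pq x; apply/cvgrPdist_le => e e0.
pose h s := \sum_j `|\sum_i (G x i j * y i 0 - G s i j * y i 0)|.
have ch : continuous h.
  apply: continuous_sum => j s; apply: cvg_norm.
  apply: (@continuous_sum _ _ _ (fun i s => G x i j * y i 0 - G s i j * y i 0)) => i {}s.
  apply: cvgB; first exact: cvg_cst.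
  by apply: cvgM; [exact: cG|exact: cvg_cst].
have hx : h x = 0.
  by apply: big1 => j _; rewrite big1 ?normr0// => i _; rewrite subrr.
have /cvgr_dist_le/(_ _ e0) := ch x; apply: filterS => s.
rewrite hx sub0r normrN => hs; rewrite (le_trans (pnorm_lip _ _ pq))//.
rewrite (le_trans _ (le_trans (ler_norm _) hs))// ler_sum// => j _.
rewrite !mxE -sumrB le_eqVlt; apply/orP; left; apply/eqP; congr (`|_|).
by apply: eq_bigr => i _; rewrite !mxE.
Qed.

End Uniform_continuity.


(** * Support function of the reach set *)

(** On [[0, t]] the truncation takes finitely many values, so the step function is a finite sum of
    multiples of indicators of preimages of half-open intervals. *)
Lemma measurable_comp_truncn (R : realType) (t c : R) (F : nat -> R) :
  0 <= c -> measurable_fun `[0, t] (fun s : R => F (Num.truncn (s * c))).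
Proof.
move=> c0; pose I k : set R := (fun s => s * c) @^-1` `[k%:R, k.+1%:R[%classic.
have mI k : measurable (I k).
  by rewrite -[I k]setTI; apply: measurable_funM.
have mF k : measurable_fun `[0, t] (fun s : R => F k * \1_(I k) s).
  by apply: measurable_funM; [exact: measurable_cst|exact: measurable_indic].
have := measurable_sum (iota 0 (Num.truncn (t * c)).+1) mF.
apply: eq_measurable_fun => s.
rewrite inE /= in_itv /= => /andP[s0 st].
have sc0 : 0 <= s * c by rewrite mulr_ge0.
have kM : (Num.truncn (s * c) < (Num.truncn (t * c)).+1)%N.
  by rewrite ltnS le_truncn// ler_wpM2r.
have kin : Num.truncn (s * c) \in iota 0 (Num.truncn (t * c)).+1 by rewrite mem_iota.
rewrite (bigD1_seq _ kin (iota_uniq _ _)) /=.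
rewrite indicE mem_set ?mulr1; last by rewrite /I /= in_itv /= truncn_itv.
rewrite big1 ?addr0// => k ks; rewrite indicE memNset ?mulr0//.
rewrite /I /= in_itv /= => skc; move: ks; rewrite (_ : Num.truncn _ = k) ?eqxx//.
exact: truncn_def.
Qed.

Section Controls.
Context (R : realType) (n m : nat) (p q : \bar R) (t : R).
Context (Phi : R -> 'M[R]_(n, m)).
Hypothesis pq : hoelder_pair p q.
Hypothesis t0 : 0 < t.
Hypothesis cPhi : forall i j, continuous (fun s => Phi s i j).
Notation mu := (@lebesgue_measure R).

Definition admissible (l : R -> R) (u : R -> 'cV[R]_m) : Prop :=
  (forall j, measurable_fun `[0, t] (fun s => u s j 0)) /\
  (forall s, 0 <= s <= t -> pnorm p (u s) <= l s).

Definition steer (u : R -> 'cV[R]_m) : 'cV[R]_n :=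
  vint `[0, t] (fun s => Phi s *m u s).

Variable l : R -> R.
Hypothesis cl : continuous l.

Let p1 : (1 <= p)%E. Proof. exact: hoelder_pair_ge1 pq. Qed.

Let qp := hoelder_pair_sym pq.

Lemma continuous_ubound_itv : exists M, forall s, 0 <= s <= t -> l s <= M.
Proof.
have [_ [M lM]] := continuous_bounded_measurable 0 t cl.
by exists M => s st; rewrite (le_trans (ler_norm _))// lM//= in_itv.
Qed.

Lemma admissible_bounded u j : admissible l u ->
  bounded_measurable `[0, t] (fun s => u s j 0).
Proof.
move=> [mu lu]; split; first exact: mu.
have [M lM] := continuous_ubound_itv.
exists M => s; rewrite /= in_itv /= => st.
by rewrite (le_trans (ler_coord_pnorm _ _ p1))// (le_trans (lu _ st))// lM.
Qed.

Lemma steer_integrable (u : R -> 'cV[R]_m) :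
  (forall j, bounded_measurable `[0, t] (fun s => u s j 0)) ->
  vintegrable `[0, t] (fun s => Phi s *m u s).
Proof.
move=> bu i; rewrite (_ : (fun s => _) = (fun s => \sum_j Phi s i j * u s j 0)).
  apply: bounded_measurable_integrable; apply: bounded_measurable_sum => // j.
  by apply: bounded_measurableM => //; exact: continuous_bounded_measurable.
by apply/funext => s; rewrite mxE.
Qed.

Lemma dot_steer (u : R -> 'cV[R]_m) y :
  (forall j, bounded_measurable `[0, t] (fun s => u s j 0)) ->
  dot y (steer u) = \int[mu]_(s in `[0, t]) dot (u s) ((Phi s)^T *m y).
Proof.
move=> bu; rewrite dot_vint//; last exact: steer_integrable.
by apply: eq_Rintegral => s _; rewrite dot_mulmx.
Qed.

Lemma continuous_integrand y :
  continuous (fun s => l s * pnorm q ((Phi s)^T *m y)).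
Proof.
have cp := continuous_pnorm_mulmx cPhi qp (y := y).
by move=> s; apply: cvgM; [exact: cl|exact: cp].
Qed.

Lemma integrable_integrand y :
  mu.-integrable `[0, t] (EFin \o (fun s => l s * pnorm q ((Phi s)^T *m y))).
Proof.
exact/bounded_measurable_integrable/continuous_bounded_measurable/continuous_integrand.
Qed.

Lemma integrable_dot (u : R -> 'cV[R]_m) y :
  (forall j, bounded_measurable `[0, t] (fun s => u s j 0)) ->
  mu.-integrable `[0, t] (EFin \o (fun s => dot (u s) ((Phi s)^T *m y))).
Proof.
move=> bu; rewrite (_ : (fun s => dot _ _) = (fun s => dot y (Phi s *m u s))).
  apply: integrable_fin_sum => // i; apply: integrable_finZ => //.
  exact: steer_integrable.
by apply/funext => s; rewrite [RHS]dot_mulmx.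
Qed.

Lemma dot_steer_le u y : admissible l u ->
  dot y (steer u) <= \int[mu]_(s in `[0, t]) (l s * pnorm q ((Phi s)^T *m y)).
Proof.
move=> au; have bu j := admissible_bounded j au; rewrite dot_steer//.
apply: le_Rintegral => //; [exact: integrable_dot|exact: integrable_integrand|].
move=> s; rewrite /= in_itv /= => st; rewrite (le_trans (dot_le_pnorm _ _ pq))//.
by rewrite ler_wpM2r ?pnorm_ge0//; have [_ ->] := au.
Qed.

(** A Hoelder maximiser at the left grid point is kept on the whole cell. It is scaled by the
    current [l s], not by the value at the grid point, so the bound holds exactly at every time.
    Half of [e] pays for moving the matrix inside the product, the other half for moving it inside
    the norm. *)
Lemma step_control (y : 'cV[R]_n) (e : R) :
  (forall s, 0 <= s <= t -> 0 <= l s) -> norm2 y <= 1 -> 0 < e ->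
  exists2 u, admissible l u &
    forall s, 0 <= s <= t ->
      l s * pnorm q ((Phi s)^T *m y) - l s * e <= dot (u s) ((Phi s)^T *m y).
Proof.
move=> l0 y1 e0; have e20 : 0 < e / 2 by rewrite divr_gt0.
have [d d0 dP] := uniform_continuous_mulmx cPhi t e20.
(* The cell length [t / K] is below [d], the modulus belonging to [e / 2]. *)
pose K := (Num.truncn (t / d)).+1; have Kd : t / K%:R < d.
  by rewrite ltr_pdivrMr// mulrC -ltr_pdivrMr// truncnS_gt.
have K0 : 0 < K%:R :> R by rewrite ltr0n.
have [U UP] : {U : nat -> 'cV[R]_m & forall k, pnorm p (U k) <= 1 /\
    dot (U k) ((Phi (k%:R * (t / K%:R)))^T *m y) =
    pnorm q ((Phi (k%:R * (t / K%:R)))^T *m y)}.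
  apply: (@choice _ _ (fun k v => pnorm p v <= 1 /\
    dot v ((Phi (k%:R * (t / K%:R)))^T *m y) =
    pnorm q ((Phi (k%:R * (t / K%:R)))^T *m y))) => k.
  by have [v] := pnorm_dual ((Phi (k%:R * (t / K%:R)))^T *m y) pq; exists v.
(* At [s = t] the index is [K]; [U] is defined on all naturals, so the right end of the interval is
   no special case. *)
exists (fun s => l s *: U (Num.truncn (s * (K%:R / t)))).
  split=> [j|s st]; last first.
    rewrite pnormZ// ger0_norm ?l0// -[leRHS]mulr1 ler_wpM2l ?l0//.
    by have [] := UP (Num.truncn (s * (K%:R / t))).
  rewrite (_ : (fun s => _) =
    (fun s => l s * (fun k => U k j 0) (Num.truncn (s * (K%:R / t))))); last first.
    by apply/funext => s; rewrite mxE.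
  have c0 : 0 <= K%:R / t by rewrite divr_ge0// ltW.
  apply: (@measurable_funM _ _ _ _ l
      (fun s => U (Num.truncn (s * (K%:R / t))) j 0)); last first.
    exact: (measurable_comp_truncn (fun k => U k j 0) c0).
  by have [] := continuous_bounded_measurable 0 t cl.
move=> s st; rewrite dotZl -mulrBr ler_wpM2l ?l0//.
set k := Num.truncn _; have [Uk1 Uk] := UP k; set s' := k%:R * (t / K%:R) in Uk.
have /andP[s0 _] := st.
have /andP[ks sk] : k%:R <= s * (K%:R / t) < k.+1%:R.
  by rewrite truncn_itv// mulr_ge0// divr_ge0// ltW.
have ss' : `|s - s'| < d.
  rewrite ger0_norm ?subr_ge0; last first.
    by rewrite /s' mulrA ler_pdivrMr// -ler_pdivlMr// -mulrA.
  apply: le_lt_trans Kd; rewrite lerBlDl /s' -[X in _ + X]mul1r -mulrDl.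
  by rewrite -natr1 in sk; rewrite mulrA ler_pdivlMr// -ler_pdivrMr// -mulrA ltW.
have ds := dP _ _ st ss' _ y1.
have := dot_le_pnorm (U k) ((Phi s')^T *m y - (Phi s)^T *m y) pq.
rewrite dotDr dotNr Uk => h1.
have h2 := pnorm_lip ((Phi s)^T *m y) ((Phi s')^T *m y) qp.
have h3 : pnorm q ((Phi s')^T *m y - (Phi s)^T *m y) <= e / 2.
  apply: le_trans (pnorm_le_sum _ qp) _; apply: le_trans ds.
  by apply: ler_sum => j _; rewrite mxE [X in _ + X]mxE distrC.
have h4 : pnorm p (U k) * pnorm q ((Phi s')^T *m y - (Phi s)^T *m y) <= e / 2.
  by apply: le_trans h3; rewrite ler_piMl ?pnorm_ge0.
have := le_trans (ler_norm _) (le_trans h2 ds).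
by move: h1 h4; lra.
Qed.

Hypothesis l0 : forall s, 0 <= s <= t -> 0 <= l s.

(** Hoelder's inequality bounds the values from above, and step controls come within any [e] of that
    bound. *)
Lemma support_steer (z0 y : 'cV[R]_n) : norm2 y <= 1 ->
  support_fun [set z | exists2 u, admissible l u & z = z0 + steer u] y =
  dot y z0 + \int[mu]_(s in `[0, t]) (l s * pnorm q ((Phi s)^T *m y)).
Proof.
move=> y1; set X := [set z | _]; set h := _ + _.
have Xub : ubound [set dot y x | x in X] h.
  move=> _ [_ [u au ->] <-]; rewrite dotDr lerD2l.
  exact: dot_steer_le.
have X0 : [set dot y x | x in X] !=set0.
  have [u au _] := step_control l0 y1 ltr01.
  by exists (dot y (z0 + steer u)), (z0 + steer u) => //; exists u.
apply/eqP; rewrite eq_le; apply/andP; split; first exact: ge_sup.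
apply/ler_addgt0Pr => e e0.
have [M lM] := continuous_ubound_itv.
(* The pointwise loss [l s * (e / (M' * t))] is at most [e / t], which integrates to [e]. The
   maximum with 1 makes the divisor positive. *)
pose M' := Num.max M 1; have M'0 : 0 < M' by rewrite lt_max ltr01 orbT.
have e'0 : 0 < e / (M' * t) by rewrite divr_gt0 ?mulr_gt0.
have [u au uP] := step_control l0 y1 e'0.
apply: (@le_trans _ _ (dot y (z0 + steer u) + e)); last first.
  rewrite lerD2r; apply: ub_le_sup; first by exists h.
  by exists (z0 + steer u) => //; exists u.
rewrite dotDr -addrA lerD2l -lerBlDr.
have bu j := admissible_bounded j au; rewrite dot_steer//.
have -> : e = \int[mu]_(s in `[0, t]) (M' * (e / (M' * t))).
  rewrite Rintegral_cst_itv ?(ltW t0)// subr0.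
  by field; rewrite !gt_eqF.
have icst (c : R) : mu.-integrable `[0, t] (EFin \o (fun=> c)).
  exact/bounded_measurable_integrable/bounded_measurable_cst.
rewrite -RintegralB//; last exact: integrable_integrand.
apply: le_Rintegral => //.
- apply: (@integrable_finD _ _ _ _ _ _ (fun=> - (M' * (e / (M' * t))))) => //.
  exact: integrable_integrand.
- exact: integrable_dot.
move=> s; rewrite /= in_itv /= => st; apply: le_trans (uP s st).
rewrite lerD2l lerN2 ler_wpM2r ?(ltW e'0)//.
by rewrite le_max lM.
Qed.

End Controls.


(** * Controls of minimal norm *)

(* The Hilbert-space projection argument: D is the limit of the least energy Q
   on the sublevel sets of F, and the parallelogram identity forces almost
   minimisers of Q on these sets to be close. *)
Lemma minimizing_sequence (R : realType) (X : Type) (adm : X -> Prop)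
    (mid : X -> X -> X) (F Q : X -> R) (Qdist : X -> X -> R) (M : R) :
  (exists u, adm u) ->
  (forall u v, adm u -> adm v -> adm (mid u v)) ->
  (forall u, 0 <= F u) ->
  (forall u v, adm u -> adm v -> F (mid u v) <= Num.max (F u) (F v)) ->
  (forall u, adm u -> 0 <= Q u <= M) ->
  (forall u v, adm u -> adm v ->
     Qdist u v = 2 * Q u + 2 * Q v - 4 * Q (mid u v)) ->
  exists v : nat -> X, [/\ forall i, adm (v i),
    forall i w, adm w -> F (v i) <= F w + 2^-1 ^+ i
    & forall i, Qdist (v i) (v i.+1) <= 4^-1 ^+ i].
Proof.
move=> [u0 au0] adm_mid F0 Fmid Q0 Qmid.
pose FA := [set F u | u in adm]; pose del := inf FA.
have FA_lb : has_inf FA.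
  by split; [exists (F u0), u0|exists 0 => _ [u _ <-]].
have sublevel e : 0 < e -> exists2 u, adm u & F u <= del + e.
  move=> e0; have [_ [u au <-] Fu] := inf_adherent e0 FA_lb.
  by exists u => //; exact: ltW.
pose low x e := forall w, adm w -> F w <= del + e -> x <= Q w.
pose DS := [set x | exists2 e, 0 < e & low x e]; pose D := sup DS.
have DS_ub : has_sup DS.
  split; first by exists 0, 1 => // w aw _; have /andP[] := Q0 _ aw.
  exists M => x [e e0 xe]; have [u au ue] := sublevel _ e0.
  by rewrite (le_trans (xe _ au ue))//; have /andP[] := Q0 _ au.
(* The parallelogram identity will give at most [2 (D + eta i) + 2 (D + eta i.+1) - 4 (D - eta i)],
   hence at most [8 * eta i]; the division by 8 turns this into [4^-1 ^+ i]. *)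
pose eta i : R := 4^-1 ^+ i / 8.
have q0 i : 0 < (4^-1 : R) ^+ i by rewrite exprn_gt0// invr_gt0.
have h0 i : 0 < (2^-1 : R) ^+ i by rewrite exprn_gt0// invr_gt0.
have eta0 i : 0 < eta i by rewrite divr_gt0.
have pick_step i : exists ve : X * R, [/\ adm ve.1, 0 < ve.2 <= 2^-1 ^+ i,
    F ve.1 <= del + ve.2, Q ve.1 <= D + eta i & low (D - eta i) ve.2].
  have [x [e e0 xe] Dx] := sup_adherent (eta0 i) DS_ub.
  pose e' := Num.min e (2^-1 ^+ i).
  have e'0 : 0 < e' by rewrite lt_min e0 h0.
  have [w [aw we Qw]] : exists w, [/\ adm w, F w <= del + e' & Q w <= D + eta i].
    (* Otherwise [D + eta i] would bound [Q] from below on a sublevel set and so exceed the supremum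
       [D] of such bounds. *)
    apply: contrapT => /forallNP nw.
    have : DS (D + eta i).
      exists e' => // w aw we; rewrite leNgt; apply/negP => Qw.
      by apply: (nw w); split => //; exact: ltW.
    by move=> /(ub_le_sup DS_ub.2); rewrite leNgt ltrDl eta0.
  exists (w, e'); split => //=; first by rewrite e'0 ge_min lexx orbT.
  move=> z az ze; rewrite (le_trans (ltW Dx))//; apply: xe => //.
  by rewrite (le_trans ze)// lerD2l ge_min lexx.
have [ve veP] := choice pick_step.
exists (fun i => (ve i).1); split=> [i|i w aw|i].
- by have [] := veP i.
- have [_ /andP[_ e2] Fv _ _] := veP i; rewrite (le_trans Fv)// lerD//.
  by apply: (ge_inf FA_lb.2); exists w.
have [a1 /andP[e1 _] F1 Q1 L1] := veP i.
have [a2 /andP[e2 _] F2 Q2 L2] := veP i.+1.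
have etaS : eta i.+1 <= eta i.
  rewrite /eta ler_pM2r// exprS ler_piMl ?(ltW (q0 i))//; lra.
rewrite Qmid//.
have : D - eta i <= Q (mid (ve i).1 (ve i.+1).1).
  have am := adm_mid _ _ a1 a2.
  (* The midpoint lies in the wider of the two sublevel sets, so the lower bound attached to that
     set applies. The widths need not decrease with [i]. *)
  have := Fmid _ _ a1 a2; have [e12|e12] := leP (ve i).2 (ve i.+1).2 => Fm.
    apply: le_trans (L2 _ am _); first by rewrite lerD2l lerN2.
    by rewrite (le_trans Fm)// ge_max F2 andbT (le_trans F1)// lerD2l.
  apply: L1 => //; by rewrite (le_trans Fm)// ge_max F1/= (le_trans F2)// lerD2l ltW.
move=> h; rewrite [leRHS](_ : _ = 8 * eta i); last by rewrite /eta mulrC divfK.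
by move: h Q1 Q2 etaS; lra.
Qed.

Section Almost_everywhere_limit.
Context (R : realType).
Notation mu := (@lebesgue_measure R).

(** The L^1 norms of the differences are summable, so the sum of the absolute differences has a
    finite integral and is finite almost everywhere; there the telescoping series converges
    absolutely. *)
Lemma ae_cvg_of_geometric (t : R) (v : nat -> R -> R) :
  0 <= t ->
  (forall i, bounded_measurable `[0, t] (v i)) ->
  (forall i, \int[mu]_(s in `[0, t]) (v i s - v i.+1 s) ^+ 2
    <= 4^-1 ^+ i) ->
  {ae mu, forall s, `[0, t]%classic s -> cvgn (fun i => v i s)}.
Proof.
move=> t0 bv v4.
pose d i s := `|v i s - v i.+1 s|.
have d0 i s : 0 <= d i s by exact: normr_ge0.
have bvB i : bounded_measurable `[0, t] (fun s => v i s - v i.+1 s).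
  have -> : (fun s => v i s - v i.+1 s) = (fun s => v i s + (-1) * v i.+1 s).
    by apply/funext => s; rewrite mulN1r.
  apply: bounded_measurableD => //; apply: bounded_measurableM => //.
  exact: bounded_measurable_cst.
have bd i : bounded_measurable `[0, t] (d i).
  have [mB [M BM]] := bvB i; split; first exact: measurableT_comp.
  by exists M => s st; rewrite normr_id; exact: BM.
have id_ i : mu.-integrable `[0, t] (EFin \o d i).
  exact: bounded_measurable_integrable.
have dle i : \int[mu]_(s in `[0, t]) d i s <= (1 + t) * 2^-1 ^+ i.
  have i2 : mu.-integrable `[0, t] (EFin \o (fun s => (v i s - v i.+1 s) ^+ 2)).
    under [X in EFin \o X]eq_fun do rewrite expr2.
    exact/bounded_measurable_integrable/bounded_measurableM.
  (* 2 |a| <= 2^i a^2 + 2^-i *)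
  apply: (@le_trans _ _ (\int[mu]_(s in `[0, t])
      (2 ^+ i * (v i s - v i.+1 s) ^+ 2 + 2^-1 ^+ i))).
    have ic : mu.-integrable `[0, t] (EFin \o (fun=> 2^-1 ^+ i : R)).
      exact/bounded_measurable_integrable/bounded_measurable_cst.
    apply: le_Rintegral => //.
      by apply: integrable_finD => //; exact: integrable_finZ.
    move=> s _; rewrite /d -[(_ - _) ^+ 2]real_normK ?num_real//.
    set b := `|_|; set x : R := 2 ^+ i; have x0 : 0 < x by rewrite exprn_gt0.
    have -> : 2^-1 ^+ i = x^-1 by rewrite exprVn.
    have := mulr_ge0 (ltW (_ : 0 < x^-1)) (sqr_ge0 (x * b - 1)).
    rewrite invr_gt0 => /(_ x0).
    have -> : x^-1 * (x * b - 1) ^+ 2 = x * b ^+ 2 + x^-1 - 2 * b.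
      by field; rewrite gt_eqF.
    have : 0 <= b by exact: normr_ge0.
    lra.
  have ic : mu.-integrable `[0, t] (EFin \o (fun=> 2^-1 ^+ i : R)).
    exact/bounded_measurable_integrable/bounded_measurable_cst.
  rewrite RintegralD//; last exact: integrable_finZ.
  (* The two terms contribute at most [2^i 4^-i] and [t 2^-i], in total [(1 + t) 2^-i]. *)
  rewrite RintegralZl// Rintegral_cst_itv// subr0 mulrDl mul1r lerD//.
    rewrite -ler_pdivlMl ?exprn_gt0// (le_trans (v4 i))// -exprVn -exprMn.
    by rewrite -invfM -natrM.
  by rewrite mulrC.
have sum_d : (\sum_(0 <= i <oo) \int[mu]_(s in `[0%R, t]) (d i s)%:E < +oo)%E.
  apply: (@le_lt_trans _ _ (((1 + t) * 2)%:E)); last exact: ltry.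
  apply: lime_le; first by apply: is_cvg_nneseries => i _ _;
    apply: integral_ge0 => s _; rewrite lee_fin d0.
  apply: nearW => k; apply: (@le_trans _ _ (\sum_(0 <= i < k) ((1 + t) * 2^-1 ^+ i)%:E)%E).
    apply: lee_sum => i _; rewrite -[leLHS]fineK; last first.
    by apply: integrable_fin_num => //; exact: id_.
    by rewrite lee_fin; exact: dle.
  rewrite sumEFin lee_fin -mulr_sumr ler_wpM2l ?addr_ge0//.
  have : 0 <= (2^-1 : R) ^+ k by rewrite exprn_ge0// invr_ge0.
  suff -> : \sum_(0 <= i < k) (2^-1 : R) ^+ i = 2 - 2 * 2^-1 ^+ k by lra.
  elim: k => [|k ih]; first by rewrite big_geq// expr0; lra.
  by rewrite big_nat_recr//= ih exprS; field.
pose f s := (\sum_(0 <= i <oo) (d i s)%:E)%E.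
have fi : mu.-integrable `[0, t] f.
  apply/integrableP; split.
    apply: ge0_emeasurable_sum => [i s _ _|i _]; first by rewrite lee_fin d0.
    by apply/measurable_EFinP; have [] := bd i.
  rewrite (_ : \int[mu]_(x in _) _ = \int[mu]_(x in `[0%R, t]) f x)%E; last first.
    apply: eq_integral => s _; rewrite gee0_abs// nneseries_ge0// => i _ _.
    by rewrite lee_fin d0.
  rewrite integral_nneseries//.
    by move=> i; apply/measurable_EFinP; have [] := bd i.
  by move=> i s _; rewrite lee_fin d0.
have fin_f : {ae mu, forall s, `[0, t]%classic s -> f s \is a fin_num}.
  exact: integrable_ae fi.
move: fin_f; apply: (@filterS _ _ (ae_filter_ringOfSetsType mu)) => s fs /fs.
rewrite ge0_fin_numE; last by apply: nneseries_ge0 => i _ _; rewrite lee_fin d0.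
move=> /(@nnseries_is_cvg _ _ (fun i => normr_ge0 _)) cd.
have : cvgn (series (telescope (v ^~ s))).
  apply: (@normed_cvg _ R^o).
  rewrite (_ : [normed _]%R = series (fun i => `|v i s - v i.+1 s|)) //.
  by apply/funext => k; apply: eq_bigr => i _; rewrite distrC.
rewrite telescopeK => cB.
have -> : (fun i => v i s) = (fun i => (v i s - v 0%N s) + v 0%N s).
  by apply/funext => i; rewrite subrK.
by apply: is_cvgD => //; exact: is_cvg_cst.
Qed.

End Almost_everywhere_limit.

Lemma cvgn_sum (R : realType) (I : Type) (r : seq I) (f : I -> nat -> R)
    (a : I -> R) :
  (forall j, f j i @[i --> \oo] --> a j) ->
  \sum_(j <- r) f j i @[i --> \oo] --> \sum_(j <- r) a j.
Proof.
move=> fa; elim: r => [|j r ih].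
  by under eq_fun do rewrite big_nil; rewrite big_nil; exact: cvg_cst.
by under eq_fun do rewrite big_cons; rewrite big_cons; exact: cvgD.
Qed.

Section Minimal_norm_control.
Context (R : realType) (n m : nat) (p q : \bar R) (t : R).
Context (Phi : R -> 'M[R]_(n, m)) (l : R -> R).
Hypothesis pq : hoelder_pair p q.
Hypothesis t0 : 0 < t.
Hypothesis cPhi : forall i j, continuous (fun s => Phi s i j).
Hypothesis cl : continuous l.
Hypothesis l0 : forall s, 0 <= s <= t -> 0 <= l s.
Notation mu := (@lebesgue_measure R).
Notation adm := (@admissible R m p t l).
Notation bounded_control u :=
  (forall j, bounded_measurable `[0, t] (fun s => (u s : 'cV[R]_m) j 0)).

Let p1 : (1 <= p)%E. Proof. exact: hoelder_pair_ge1 pq. Qed.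

Let adm_bounded u : adm u -> bounded_control u.
Proof. by move=> au j; exact: (admissible_bounded pq cl j au). Qed.

Lemma bounded_measurable_dot (u v : R -> 'cV[R]_m) :
  bounded_control u -> bounded_control v ->
  bounded_measurable `[0, t] (fun s => dot (u s) (v s)).
Proof.
by move=> bu bv; apply: bounded_measurable_sum => // j; exact: bounded_measurableM.
Qed.

Lemma bounded_control_lin (a b : R) (u v : R -> 'cV[R]_m) :
  bounded_control u -> bounded_control v ->
  bounded_control (fun s => a *: u s + b *: v s).
Proof.
move=> bu bv j; rewrite (_ : (fun s => _) = (fun s => a * u s j 0 + b * v s j 0)).
  apply: bounded_measurableD => //; apply: bounded_measurableM => //;
    exact: bounded_measurable_cst.
by apply/funext => s; rewrite !mxE.
Qed.

Lemma steer_lin (a b : R) (u v : R -> 'cV[R]_m) :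
  bounded_control u -> bounded_control v ->
  steer t Phi (fun s => a *: u s + b *: v s) =
  a *: steer t Phi u + b *: steer t Phi v.
Proof.
move=> bu bv; have iu := steer_integrable cPhi bu; have iv := steer_integrable cPhi bv.
rewrite /steer -[a *: _]mul_scalar_mx -[b *: _]mul_scalar_mx -!vint_mulmx//.
rewrite -vintD//; [|exact: vintegrable_mulmx..].
by apply: eq_vint => s _; rewrite mulmxDr -!scalemxAr !mul_scalar_mx.
Qed.

Lemma admissible_convex (a b : R) u v : 0 <= a -> 0 <= b -> a + b = 1 ->
  adm u -> adm v -> adm (fun s => a *: u s + b *: v s).
Proof.
move=> a0 b0 ab au av; split=> [j|s st].
  by have [] := bounded_control_lin a b (adm_bounded au) (adm_bounded av) j.
rewrite (le_trans (ler_pnormD _ _ pq))// !pnormZ// !ger0_norm//.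
have [_ /(_ s st) us] := au; have [_ /(_ s st) vs] := av.
by rewrite -[leRHS]mul1r -ab mulrDl lerD// ler_wpM2l.
Qed.

Let M_ex : exists2 M, 0 <= M & forall (u : R -> 'cV[R]_m) s j,
    adm u -> 0 <= s <= t -> `|u s j 0| <= M.
Proof.
have [M lM] := continuous_ubound_itv t cl.
exists `|M| => // u s j [_ ul] st; rewrite (le_trans (ler_coord_pnorm _ _ p1))//.
by rewrite (le_trans (ul _ st))// (le_trans (lM _ st))// ler_norm.
Qed.

(** The squared norm [F] is the criterion to minimise and the energy [Q] the one that separates
    controls. The almost everywhere limit of the sequence is admissible, and dominated convergence
    carries the values of [F] to it. *)
Lemma steer_min_norm (c : 'cV[R]_n) : exists2 w, adm w &
  forall u, adm u -> dot (c + steer t Phi w) (c + steer t Phi w) <=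
                     dot (c + steer t Phi u) (c + steer t Phi u).
Proof.
have [M M0 uM] := M_ex.
pose F u := dot (c + steer t Phi u) (c + steer t Phi u).
pose Q u := \int[mu]_(s in `[0, t]) dot (u s : 'cV[R]_m) (u s).
pose mid (u v : R -> 'cV[R]_m) := fun s => 2^-1 *: u s + 2^-1 *: v s.
pose dif (u v : R -> 'cV[R]_m) := fun s => 1 *: u s + (-1) *: v s.
have iQ (u v : R -> 'cV[R]_m) : adm u -> adm v ->
    mu.-integrable `[0, t] (EFin \o (fun s => dot (u s) (v s))).
  move=> /adm_bounded bu /adm_bounded bv.
  exact/bounded_measurable_integrable/bounded_measurable_dot.
have ex_adm : exists u, adm u.
  exists (fun=> 0); split=> [j|s st]; first exact: measurable_cst.
  by rewrite pnorm0// l0.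
have adm_mid u v : adm u -> adm v -> adm (mid u v).
  by apply: admissible_convex; rewrite ?invr_ge0//; lra.
have F_ge0 u : 0 <= F u by exact: dot_ge0.
have F_mid u v : adm u -> adm v -> F (mid u v) <= Num.max (F u) (F v).
  move=> au av; rewrite /F steer_lin; [|exact: adm_bounded..].
  set a := c + steer t Phi u; set b := c + steer t Phi v.
  have -> : c + (2^-1 *: steer t Phi u + 2^-1 *: steer t Phi v) =
      2^-1 *: a + 2^-1 *: b.
    rewrite /a /b !scalerDr addrACA -scalerDl [X in X *: c](_ : _ = 1); last lra.
    by rewrite scale1r.
  clearbody a b; have := dot_ge0 (a - b); rewrite !(dotDr, dotDl, dotZl, dotZr, dotNl, dotNr).
  have : dot a a <= Num.max (dot a a) (dot b b) by rewrite le_max lexx.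
  have : dot b b <= Num.max (dot a a) (dot b b) by rewrite le_max lexx orbT.
  by rewrite (dotC b a); lra.
have Q_bound u : adm u -> 0 <= Q u <= m%:R * (M * M) * t.
  move=> au; apply/andP; split; first by apply: Rintegral_ge0 => s _; exact: dot_ge0.
  rewrite -[X in _ <= _ * X]subr0 -Rintegral_cst_itv ?(ltW t0)// /Q; apply: le_Rintegral => //.
  - exact: iQ.
  - exact/bounded_measurable_integrable/bounded_measurable_cst.
  move=> s; rewrite /= in_itv /= => st.
  rewrite mulr_natl -[X in _ <= _ *+ X]card_ord -sumr_const ler_sum// => j _.
  by rewrite (le_trans (ler_norm _))// normrM ler_pM//; exact: uM.
have Q_dif u v : adm u -> adm v ->
    Q (dif u v) = 2 * Q u + 2 * Q v - 4 * Q (mid u v).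
  move=> au av; have am := adm_mid _ _ au av.
  rewrite /Q -!RintegralZl//; [|exact: iQ..].
  rewrite -RintegralD//; [|exact: integrable_finZ (iQ _ _ _ _)..].
  rewrite -RintegralB//; last 2 first.
  - by apply: integrable_finD => //; apply: integrable_finZ => //; exact: iQ.
  - by apply: integrable_finZ => //; exact: iQ.
  apply: eq_Rintegral => s _; rewrite /dif /mid.
  rewrite !(dotDr, dotDl, dotZl, dotZr, dotNl, dotNr) (dotC (v s) (u s)).
  by field.
have [v [av Fv Qv]] := minimizing_sequence ex_adm adm_mid
  F_ge0 F_mid Q_bound Q_dif.
have bv i := adm_bounded (av i).
have vcvg j : {ae mu, forall s, `[0, t]%classic s -> cvgn (fun i => v i s j 0)}.
  apply: ae_cvg_of_geometric => [|i|i]; [exact: ltW|exact: bv|].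
  (* The square of one coordinate of the difference is at most the energy density of the whole
     difference. *)
  apply: le_trans (Qv i); apply: le_Rintegral => //.
  - under [X in EFin \o X]eq_fun do rewrite expr2.
    have bd : bounded_measurable `[0, t] (fun s => v i s j 0 - v i.+1 s j 0).
      have := bounded_control_lin 1 (-1) (bv i) (bv i.+1) j.
      by congr (bounded_measurable _ _); apply/funext => s; rewrite !mxE; ring.
    exact/bounded_measurable_integrable/bounded_measurableM.
  - apply/bounded_measurable_integrable/bounded_measurable_dot;
      exact: bounded_control_lin.
  move=> s _; rewrite /dif /dot (bigD1 j)//= !mxE -expr2 mul1r mulN1r lerDl.
  by rewrite sumr_ge0// => k _; rewrite -expr2 sqr_ge0.
have [N [mN N0 NP]] : {ae mu, forall s, forall j, `[0, t]%classic s ->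
    cvgn (fun i => v i s j 0)}.
  exact: (@filter_forall _ _ _ _ (ae_filter_ringOfSetsType mu) vcvg).
have vN s j : `[0, t]%classic s -> ~ N s -> cvgn (fun i => v i s j 0).
  by move=> st Ns; apply: contrapT => nc; apply: Ns; apply: NP => /(_ j st).
have iN s : N s -> \1_(~` N) s = 0 :> R.
  by move=> Ns; rewrite indicE memNset//= => /(_ Ns).
have iNC s : ~ N s -> \1_(~` N) s = 1 :> R.
  by move=> Ns; rewrite indicE mem_set.
(* The constraint is imposed at every time, so [w] is set to 0 on the exceptional null set, where 0
   satisfies it. The controls cut off by the same indicator converge to [w] on the whole interval,
   which gives measurability. *)
pose w s : 'cV[R]_m := \col_j (limn (fun i => v i s j 0) * \1_(~` N) s).
have w_lim s j : `[0, t]%classic s -> ~ N s ->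
    (fun i => v i s j 0) @ \oo --> w s j 0.
  move=> st Ns; rewrite mxE iNC// mulr1; exact: vN.
have w0 s : N s -> w s = 0.
  by move=> Ns; apply/colP => j; rewrite !mxE iN// mulr0.
have aw : adm w.
  split=> [j|s st].
    apply: (@measurable_fun_cvg _ _ _ _ (fun i s => v i s j 0 * \1_(~` N) s)).
      move=> i; apply: measurable_funM; first by have [] := bv i j.
      by apply: measurable_indic; exact: measurableC.
    move=> s st; have [Ns|Ns] := pselect (N s).
      rewrite w0// mxE iN//; under eq_fun do rewrite mulr0; exact: cvg_cst.
    rewrite iNC//; under eq_fun do rewrite mulr1; exact: w_lim.
  have [Ns|Ns] := pselect (N s); first by rewrite w0// pnorm0// l0.
  have st' : `[0, t]%classic s by rewrite /= in_itv.
  (* The constraint passes to the limit: [pnorm p (w s) - l s] is at most [D i], which tends to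
     0. *)
  pose D i := \sum_j `|w s j 0 - v i s j 0|.
  have D0 : D i @[i --> \oo] --> 0.
    have -> : 0 = \sum_(j < m) `|w s j 0 - w s j 0| :> R.
      by rewrite big1// => j _; rewrite subrr normr0.
    apply: cvgn_sum => j; apply: cvg_norm; apply: cvgB; first exact: cvg_cst.
    exact: w_lim.
  have lD i : pnorm p (w s) - l s <= D i.
    have [_ /(_ s st) vl] := av i.
    have := le_trans (ler_norm _) (pnorm_lip (w s) (v i s) pq).
    by rewrite -/(D i); lra.
  rewrite -subr_le0 -(cvg_lim _ D0)//; apply: limr_ge; first by apply/cvg_ex; exists 0.
  by apply: nearW.
have bw := adm_bounded aw.
have steer_lim k : steer t Phi (v i) k 0 @[i --> \oo] --> steer t Phi w k 0.
  pose f_ i s := ((Phi s *m v i s) k 0)%:E; pose f s := ((Phi s *m w s) k 0)%:E.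
  (* The common bound [M] on the coordinates of admissible controls gives a continuous dominating
     function independent of [i]. *)
  pose g s := (\sum_j `|Phi s k j| * M)%:E.
  have iv i : mu.-integrable `[0, t] (f_ i) by exact: (steer_integrable cPhi (bv i)).
  have iw : mu.-integrable `[0, t] f by exact: (steer_integrable cPhi bw).
  have ig : mu.-integrable `[0, t] g.
    apply/bounded_measurable_integrable/continuous_bounded_measurable.
    apply: continuous_sum => j s; apply: cvgM; last exact: cvg_cst.
    by apply: cvg_norm; exact: cPhi.
  have f_f : {ae mu, forall s, `[0, t]%classic s -> f_ i s @[i --> \oo] --> f s}.
    exists N; split => // s /= sP; apply: contrapT => Ns; apply: sP => st.
    apply: cvg_EFin; first exact: nearW.
    rewrite mxE (_ : _ \o _ = (fun i => \sum_j Phi s k j * v i s j 0)).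
      by apply: cvgn_sum => j; apply: cvgM; [exact: cvg_cst|exact: w_lim].
    by apply/funext => i /=; rewrite mxE.
  have f_g : {ae mu, forall s i, `[0, t]%classic s -> (`|f_ i s| <= g s)%E}.
    apply: aeW => s i; rewrite /= in_itv /= => st.
    rewrite lee_fin mxE (le_trans (ler_norm_sum _ _ _))// ler_sum// => j _.
    by rewrite normrM ler_wpM2l//; exact: uM.
  have [_ _] := @dominated_convergence _ _ R mu `[0, t]%classic (measurable_itv _)
    f_ f g (fun i => measurable_int _ (iv i)) (measurable_int _ iw) f_f ig f_g.
  have -> : steer t Phi w k 0 = fine (\int[mu]_(s in `[0, t]) f s) by rewrite mxE.
  have -> : (fun i => steer t Phi (v i) k 0) =
      fine \o (fun i => \int[mu]_(s in `[0%R, t]) f_ i s)%E.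
    by apply/funext => i; rewrite mxE.
  move=> DC; apply: fine_cvg; rewrite fineK//.
  exact: integrable_fin_num.
have F_lim : F (v i) @[i --> \oo] --> F w.
  have coord k : (c + steer t Phi (v i)) k 0 @[i --> \oo] -->
      (c + steer t Phi w) k 0.
    rewrite mxE; under eq_fun do rewrite mxE.
    by apply: cvgD; [exact: cvg_cst|exact: steer_lim].
  apply: (@cvgn_sum _ _ _ (fun k i => (c + steer t Phi (v i)) k 0 *
    (c + steer t Phi (v i)) k 0)) => k.
  by apply: cvgM; exact: coord.
exists w => // u au; rewrite -/(F u) -/(F w).
(* Along the sequence minimality holds up to [2^-1 ^+ i]; the error disappears in the limit. *)
have half0 : (2^-1 : R) ^+ i @[i --> \oo] --> 0.
  by apply: cvg_expr; rewrite ger0_norm// invf_lt1// ltr1n.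
have Flim : F (v i) - 2^-1 ^+ i @[i --> \oo] --> F w.
  by rewrite -[X in _ --> X]subr0; exact: cvgB.
rewrite -(cvg_lim _ Flim)//; apply: limr_le; first by apply/cvg_ex; exists (F w).
by apply: nearW => i /=; rewrite lerBlDr; exact: Fv.
Qed.

End Minimal_norm_control.


(** * Minima over the ball and the sphere *)

Section Compact_minimum.
Context (R : realType) (n : nat).

Lemma norm2_le1 (y : 'cV[R]_n) : (norm2 y <= 1) = (dot y y <= 1).
Proof. by rewrite /norm2 -[X in _ <= X]sqrtr1 ler_sqrt. Qed.

Lemma norm2_eq1 (y : 'cV[R]_n) : norm2 y = 1 <-> dot y y = 1.
Proof.
rewrite /norm2; split=> [y1|->]; last by rewrite sqrtr1.
by rewrite -[LHS]sqr_sqrtr ?dot_ge0// y1 expr1n.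
Qed.

Lemma norm2_normalize (y : 'cV[R]_n) : y != 0 -> norm2 ((norm2 y)^-1 *: y) = 1.
Proof.
move=> y0; apply/norm2_eq1; have y2 := dot_gt0 y0.
rewrite dotZl dotZr /norm2 mulrA -expr2 exprVn sqr_sqrtr ?(ltW y2)//.
by rewrite mulVf ?gt_eqF.
Qed.

Lemma norm2_gt0 (y : 'cV[R]_n) : y != 0 -> 0 < norm2 y.
Proof. by move=> y0; rewrite sqrtr_gt0 dot_gt0. Qed.

(** Transposition moves the problem to row vectors, where compactness is obtained from
    [bounded_closed_compact]. *)
Lemma continuous_lip (phi : 'cV[R]_n -> R) (C : R) :
  (forall y z, `|phi y - phi z| <= C * \sum_i `|y i 0 - z i 0|) ->
  continuous (fun v : 'rV[R]_n => phi v^T).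
Proof.
move=> phiC v; apply/(cvgrPdist_le (FF := nbhs_filter v)) => e e0.
pose h (w : 'rV[R]_n) := C * \sum_i `|v 0 i - w 0 i|.
have ch : continuous h.
  move=> w; apply: continuousM; first exact: cst_continuous.
  apply: (@continuous_sum _ _ _ _ (fun i (w : 'rV[R]_n) => `|v 0 i - w 0 i|)) => i {}w.
  apply: (@continuous_comp _ _ _ (fun w : 'rV[R]_n => v 0 i - w 0 i)); last first.
    exact: norm_continuous.
  by apply: continuousB; [exact: cst_continuous|exact: coord_continuous].
have hv : h v = 0.
  by rewrite /h big1 ?mulr0// => i _; rewrite subrr normr0.
have /(cvgr_dist_le (FF := nbhs_filter v))/(_ _ e0) := ch v.
apply: (@filterS _ _ (nbhs_filter v)) => w.
rewrite hv sub0r normrN => hw; rewrite (le_trans (phiC _ _))//.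
apply: le_trans hw; apply: le_trans (ler_norm _); rewrite le_eqVlt; apply/orP; left.
by apply/eqP; congr (_ * _); apply: eq_bigr => i _; rewrite !mxE.
Qed.

Lemma continuous_dot : continuous (fun v : 'rV[R]_n => dot v^T v^T).
Proof.
move=> v; have -> : (fun v : 'rV[R]_n => dot v^T v^T) = (fun v => \sum_i v 0 i * v 0 i).
  by apply/funext => w; apply: eq_bigr => i _; rewrite !mxE.
apply: (@continuous_sum _ _ _ _ (fun i (w : 'rV[R]_n) => w 0 i * w 0 i)) => i w.
by apply: continuousM; exact: coord_continuous.
Qed.

(** Ball and sphere are both cut out by a closed condition [V] on [dot y y], so one compactness
    argument serves both. *)
Lemma min_closed_subball (phi : 'cV[R]_n -> R) (C : R) (V : set R) :
  (forall y z, `|phi y - phi z| <= C * \sum_i `|y i 0 - z i 0|) ->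
  closed V -> V `<=` [set x | x <= 1] ->
  (exists y : 'cV[R]_n, V (dot y y)) ->
  exists2 y : 'cV[R]_n, V (dot y y) & forall z, V (dot z z) -> phi y <= phi z.
Proof.
move=> phiC cV V1 [y0 Vy0]; pose S := [set v : 'rV[R]_n | V (dot v^T v^T)].
have S0 : S !=set0 by exists y0^T; rewrite /S /= trmxK.
have cS : compact S.
  apply: bounded_closed_compact; last first.
    exact: (closed_comp (fun v _ => @continuous_dot v) cV).
  exists 1; split; first exact: num_real.
  move=> x x1 v /V1 /= v1; rewrite [leLHS]mx_normrE; apply: bigmax_le => /=.
    exact: ltW (lt_trans ltr01 x1).
  move=> [i j] _ /=; rewrite ord1; apply: le_trans (ltW x1).
  rewrite -[leRHS](ger0_norm ler01) -ler_sqr ?nnegrE// -[leLHS]normrX -[leRHS]normrX.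
  rewrite !ger0_norm ?sqr_ge0// expr1n (le_trans _ v1)// /dot (bigD1 j)//= !mxE -expr2.
  by rewrite lerDl sumr_ge0// => k _; rewrite -expr2 sqr_ge0.
have [v vS vmin] := compact_EVT_min S0 cS (continuous_subspaceT (continuous_lip phiC)).
exists v^T; first by rewrite inE in vS.
by move=> z Vz; rewrite -[z]trmxK; apply: vmin; rewrite inE /S /= trmxK.
Qed.

Lemma min_ball (phi : 'cV[R]_n -> R) (C : R) :
  (forall y z, `|phi y - phi z| <= C * \sum_i `|y i 0 - z i 0|) ->
  exists2 y, norm2 y <= 1 & forall z, norm2 z <= 1 -> phi y <= phi z.
Proof.
move=> phiC; have [|//||y y1 ymin] := @min_closed_subball phi C [set x | x <= 1] phiC.
- exact: closed_le.
- by exists 0; rewrite /= dot0r ler01.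
exists y; first by rewrite norm2_le1.
by move=> z; rewrite norm2_le1; exact: ymin.
Qed.

Lemma min_sphere (phi : 'cV[R]_n -> R) (C : R) : (0 < n)%N ->
  (forall y z, `|phi y - phi z| <= C * \sum_i `|y i 0 - z i 0|) ->
  exists2 y, norm2 y = 1 & forall z, norm2 z = 1 -> phi y <= phi z.
Proof.
move=> n0 phiC; have [|||y /= y1 ymin] := @min_closed_subball phi C [set 1] phiC.
- exact: closed_eq.
- by move=> x /= ->.
- exists (delta_mx (Ordinal n0) 0) => /=; rewrite /dot (bigD1 (Ordinal n0))//=.
  rewrite big1 ?addr0 ?mxE ?eqxx ?mulr1// => i /negPf i0.
  by rewrite mxE i0 mul0r.
exists y; first exact/norm2_eq1.
by move=> z /norm2_eq1; exact: ymin.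
Qed.

Lemma is_minimum_inf (S : set R) (v : R) : is_minimum S v -> inf S = v.
Proof.
move=> [Sv lv]; apply/eqP; rewrite eq_le; apply/andP; split.
  by apply: ge_inf => //; exists v.
by apply: lb_le_inf => //; exists v.
Qed.

End Compact_minimum.


(** * Trapezoidal rule *)

Section Trapezoid_rule.
Context (R : realType).
Notation mu := (@lebesgue_measure R).

Lemma Rintegral_dist_cst (a b c e : R) (g : R -> R) : a <= b ->
  mu.-integrable `[a, b] (EFin \o g) ->
  (forall s, a <= s <= b -> `|c - g s| <= e) ->
  `|(b - a) * c - \int[mu]_(s in `[a, b]) g s| <= e * (b - a).
Proof.
move=> ab ig cg.
have ic x : mu.-integrable `[a, b] (EFin \o (fun=> x : R)).
  exact/bounded_measurable_integrable/bounded_measurable_cst.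
have iB : mu.-integrable `[a, b] (EFin \o (fun s => c - g s)).
  rewrite (_ : (fun s => _) = (fun s => c + (-1) * g s)).
    by apply: integrable_finD => //; exact: integrable_finZ.
  by apply/funext => s; rewrite mulN1r.
rewrite [(b - a) * c]mulrC -!Rintegral_cst_itv// -RintegralB//.
rewrite (le_trans (le_normr_Rintegral _ iB))//.
apply: le_Rintegral => //.
  by have := integrable_norm iB.
Qed.

Lemma Rintegral_itv_cat (a b c : R) (g : R -> R) : a <= b -> b <= c ->
  mu.-integrable `[a, c] (EFin \o g) ->
  \int[mu]_(s in `[a, c]) g s =
  \int[mu]_(s in `[a, b]) g s + \int[mu]_(s in `[b, c]) g s.
Proof.
move=> ab bc ig; have ibc : mu.-integrable `]b, c] (EFin \o g).
  apply: integrableS ig => //; apply: subset_itvr; rewrite bnd_simp.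
  exact: le_trans ab _.
rewrite -(Rintegral_itv_obnd_cbnd ibc) -(Rintegral_itvB (x := b) ig) ?bnd_simp//.
by rewrite subrKC.
Qed.

(** Each end weight is a full weight minus one half, and the nodes regroup into panel averages. For
    [0 < K] the two end nodes are distinct, so each loses its own half. *)
Lemma dot_trapezoid_weights (t : R) (K : nat) (a : nat -> R) : (0 < K)%N ->
  dot (trapezoid_weights t K) (\col_k a k) =
  \sum_(k < K) (t / K%:R) * ((a k + a k.+1) / 2).
Proof.
move=> K0; have -> : dot (trapezoid_weights t K) (\col_k a k) =
    \sum_(k < K.+1) (t / K%:R) * (a k - a 0%N / 2 *+ (k == 0 :> nat)
      - a K / 2 *+ (k == K :> nat)).
  apply: eq_bigr => k _; rewrite !mxE -mulrA; congr (_ * _).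
  have [->|k0] := eqVneq (k : nat) 0%N.
    by rewrite (ltn_eqF K0) /= mulr1n mulr0n; lra.
  have [->|kK] := eqVneq (k : nat) K; rewrite /= !(mulr0n, mulr1n); lra.
rewrite -!mulr_sumr; congr (_ * _).
rewrite sumrB sumrB -mulr_suml big_split /=.
have s0 : \sum_(k < K.+1) a 0%N / 2 *+ (k == 0 :> nat) = a 0%N / 2.
  by rewrite big_ord_recl /= mulr1n big1 ?addr0// => k _; rewrite mulr0n.
have sK : \sum_(k < K.+1) a K / 2 *+ (k == K :> nat) = a K / 2.
  rewrite big_ord_recr /= eqxx mulr1n big1 ?add0r// => k _.
  by rewrite (ltn_eqF (ltn_ord k)) mulr0n.
rewrite s0 sK.
have h1 : \sum_(k < K.+1) a k = \sum_(k < K) a k + a K by rewrite big_ord_recr.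
have h2 : \sum_(k < K.+1) a k = a 0%N + \sum_(k < K) a k.+1 by rewrite big_ord_recl.
move: h1 h2; lra.
Qed.

(** On a panel both end values differ from [g] by at most [e], hence so does their mean. Only a
    modulus of continuity enters, which suits integrands that are norms and may have kinks. *)
Lemma trapezoid_error (t e : R) (K : nat) (g : R -> R) : (0 < K)%N -> 0 <= t ->
  mu.-integrable `[0, t] (EFin \o g) ->
  (forall s s', 0 <= s <= t -> 0 <= s' <= t -> `|s - s'| <= t / K%:R ->
     `|g s - g s'| <= e) ->
  `|dot (trapezoid_weights t K) (\col_k g (k%:R * (t / K%:R))) -
    \int[mu]_(s in `[0, t]) g s| <= e * t.
Proof.
move=> K0 t0 ig ge.
rewrite (@dot_trapezoid_weights t K (fun k => g (k%:R * (t / K%:R))))//.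
set h := t / K%:R; have K0' : 0 < K%:R :> R by rewrite ltr0n.
have h0 : 0 <= h by rewrite divr_ge0// ltW.
have hK : K%:R * h = t by rewrite /h mulrC divfK// gt_eqF.
suff H j : (j <= K)%N -> `|\sum_(k < j)
    h * ((g (k%:R * h) + g (k.+1%:R * h)) / 2) -
    \int[mu]_(s in `[0, j%:R * h]) g s| <= e * (j%:R * h).
  by have := H K (leqnn K); rewrite hK.
elim: j => [_|j ih jK].
  by rewrite big_ord0 mul0r set_itv1 Rintegral_set1 subrr normr0 mulr0.
have j0 : 0 <= j%:R * h by rewrite mulr_ge0.
have jj : j%:R * h <= j.+1%:R * h by rewrite ler_wpM2r// ler_nat.
have jt : j.+1%:R * h <= t by rewrite -hK ler_wpM2r// ler_nat.
have hE : j.+1%:R * h - j%:R * h = h by rewrite -mulrBl -natrB// subSnn mul1r.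
have ij : mu.-integrable `[0, j.+1%:R * h] (EFin \o g).
  by apply: integrableS ig => //; apply: subset_itvl; rewrite bnd_simp.
rewrite big_ord_recr /= (Rintegral_itv_cat j0 jj ij) opprD addrACA.
have -> : e * (j.+1%:R * h) = e * (j%:R * h) + e * h by rewrite -natr1; ring.
rewrite (le_trans (ler_normD _ _))//.
rewrite lerD ?ih 1?ltnW//.
rewrite -{1}hE -[X in e * X]hE; apply: Rintegral_dist_cst => //.
  apply: integrableS ij => //; apply: subset_itvr; by rewrite bnd_simp.
move=> s /andP[js sj].
have st : 0 <= s <= t by rewrite (le_trans j0 js) (le_trans sj jt).
have g1 : `|g (j%:R * h) - g s| <= e.
  apply: ge => //; first by rewrite j0 (le_trans jj jt).
  by rewrite distrC ger0_norm ?subr_ge0// -/h -[leRHS]hE lerD2r.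
have g2 : `|g (j.+1%:R * h) - g s| <= e.
  apply: ge => //; first by rewrite (le_trans j0 jj).
  by rewrite ger0_norm ?subr_ge0// -/h -[leRHS]hE lerD2l lerN2.
move: g1 g2; rewrite !ler_norml => /andP[? ?] /andP[? ?]; apply/andP; split; lra.
Qed.

(** Passes between elapsed time, in which controls act, and the time to go, in which [Gmx] is
    written. *)
Lemma Rintegral_reflect (t : R) (g : R -> R) : 0 <= t -> continuous g ->
  \int[mu]_(s in `[0, t]) g (t - s) = \int[mu]_(s in `[0, t]) g s.
Proof.
move=> t0 cg; rewrite /Rintegral; congr fine.
have dF x : is_derive x (1 : R) (fun s : R => t - s) (-1).
  by rewrite -[X in is_derive _ _ _ X]sub0r; exact: is_deriveB.
have DF : derive1 (fun s : R => t - s) = cst (-1).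
  by apply/funext => x; rewrite derive1E; have [_ ->] := dF x.
have := @integration_by_substitution_decreasing R (fun s => t - s) g 0 t t0.
rewrite subrr subr0 DF => -> //.
- apply: eq_integral => s _; congr EFin.
  by rewrite /= !fctE /= opprK mulr1.
- by move=> x y _ _ xy; rewrite ltrD2l ltrN2.
- by move=> x _; exact: cst_continuous.
- exact: is_cvg_cst.
- exact: is_cvg_cst.
- have cF x : {for x, continuous (fun s : R => t - s)}.
    by apply: continuousB; [exact: cst_continuous|exact: cvg_id].
  split => [x _| |]; first by have [] := dF x.
  + exact/cvg_at_right_filter/cF.
  + exact/cvg_at_left_filter/cF.
- exact: continuous_subspaceT.
Qed.

End Trapezoid_rule.

(** * The relaxed problem on the ball and its discretisation *)

Section Gauge_integral.
Context (R : realType) (n m : nat) (p q : \bar R) (t : R).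
Context (c : 'cV[R]_n) (G : R -> 'M[R]_(n, m)).
Hypothesis pq : hoelder_pair p q.
Hypothesis t0 : 0 < t.
Hypothesis cG : forall i j, continuous (fun s => G s i j).
Notation mu := (@lebesgue_measure R).

Let qp := hoelder_pair_sym pq.

Let gauge (y : 'cV[R]_n) (s : R) : R := pnorm q ((G s)^T *m y).

Definition gauge_integral (y : 'cV[R]_n) : R :=
  dot c y + \int[mu]_(s in `[0, t]) pnorm q ((G s)^T *m y).

Definition gauge_trapezoid (K : nat) (y : 'cV[R]_n) : R :=
  dot c y + dot (trapezoid_weights t K)
    (\col_k pnorm q ((G (k%:R * (t / K%:R)))^T *m y)).

Lemma integrable_gauge y : mu.-integrable `[0, t] (EFin \o gauge y).
Proof.
apply/bounded_measurable_integrable/continuous_bounded_measurable.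
exact: (continuous_pnorm_mulmx cG qp).
Qed.

Lemma gauge_lip : exists2 L, 0 <= L & forall s y z, 0 <= s <= t ->
  `|gauge y s - gauge z s| <= L * \sum_i `|y i 0 - z i 0|.
Proof.
pose h s := \sum_i \sum_j `|G s i j|.
have ch : continuous h.
  apply: continuous_sum => i; apply: continuous_sum => j s.
  by apply: cvg_norm; exact: cG.
have [_ [L hL]] := continuous_bounded_measurable 0 t ch.
have L0 : 0 <= L.
  by apply: le_trans (hL 0 _); rewrite ?normr_ge0//= in_itv/= lexx ltW.
exists L => // s y z st; rewrite (le_trans (pnorm_lip _ _ qp))//.
apply: (@le_trans _ _ (\sum_j \sum_i `|G s i j| * `|y i 0 - z i 0|)).
  apply: ler_sum => j _; rewrite !mxE -sumrB (le_trans (ler_norm_sum _ _ _))//.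
  by apply: ler_sum => i _; rewrite !mxE -mulrBr normrM.
rewrite exchange_big mulr_sumr; apply: ler_sum => i _ /=.
rewrite -mulr_suml ler_wpM2r//.
have hs : h s <= L by rewrite (le_trans (ler_norm _))// hL//= in_itv.
apply: le_trans hs; rewrite /h (bigD1 i)//= lerDl.
by do 2 (rewrite sumr_ge0// => ? _).
Qed.

Let dot_lip (k : nat) (a x y : 'cV[R]_k) :
  `|dot a x - dot a y| <= (\sum_i `|a i 0|) * \sum_i `|x i 0 - y i 0|.
Proof.
rewrite -dotNr -dotDr mulr_suml (le_trans (ler_norm_sum _ _ _))// ler_sum// => i _.
rewrite !mxE normrM ler_wpM2l// (bigD1 i)//= lerDl.
by rewrite sumr_ge0.
Qed.

Lemma gauge_integral_lip : exists C, forall y z,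
  `|gauge_integral y - gauge_integral z| <= C * \sum_i `|y i 0 - z i 0|.
Proof.
have [L L0 gL] := gauge_lip.
exists (\sum_i `|c i 0| + L * t) => y z; set S := \sum_i `|y i 0 - z i 0|.
rewrite /gauge_integral opprD addrACA (le_trans (ler_normD _ _))// mulrDl.
rewrite lerD ?dot_lip// -RintegralB//; [|exact: integrable_gauge..].
have iB : mu.-integrable `[0, t] (EFin \o (fun s => gauge y s - gauge z s)).
  rewrite (_ : (fun s => _) = (fun s => gauge y s + (-1) * gauge z s)).
    apply: integrable_finD => //; last apply: integrable_finZ => //;
      exact: integrable_gauge.
  by apply/funext => s; rewrite mulN1r.
rewrite (le_trans (le_normr_Rintegral _ iB))//.
have -> : L * t * S = L * S * (t - 0) by rewrite subr0; ring.
rewrite -Rintegral_cst_itv ?(ltW t0)//; apply: le_Rintegral => //.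
- by have := integrable_norm iB.
- exact/bounded_measurable_integrable/bounded_measurable_cst.
- by move=> s; rewrite /= in_itv /= => st; exact: gL.
Qed.

Lemma gauge_trapezoid_lip K : exists C, forall y z,
  `|gauge_trapezoid K y - gauge_trapezoid K z| <= C * \sum_i `|y i 0 - z i 0|.
Proof.
have [L L0 gL] := gauge_lip; have [->|K0] := posnP K.
  (* For [K = 0] the step [t / 0] is 0, so all weights vanish and only the linear term is left. *)
  exists (\sum_i `|c i 0|) => y z; rewrite /gauge_trapezoid.
  have w0 a : dot (trapezoid_weights t 0) a = 0.
    by rewrite /dot big1// => i _; rewrite mxE invr0 mulr0 !mul0r.
  by rewrite !w0 !addr0 dot_lip.
pose W := \sum_k `|trapezoid_weights t K k 0|.
exists (\sum_i `|c i 0| + W * (L *+ K.+1)) => y z; set S := \sum_i `|y i 0 - z i 0|.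
rewrite /gauge_trapezoid opprD addrACA (le_trans (ler_normD _ _))// mulrDl.
rewrite lerD ?dot_lip// (le_trans (dot_lip _ _ _))// -mulrA ler_wpM2l ?sumr_ge0//.
have -> : L *+ K.+1 * S = \sum_(k < K.+1) L * S.
  by rewrite sumr_const card_ord mulrnAl.
apply: ler_sum => k _.
rewrite !mxE; apply: gL; have K0' : 0 < K%:R :> R by rewrite ltr0n.
apply/andP; split; first by rewrite mulr_ge0// divr_ge0// ltW.
rewrite mulrCA ler_piMr ?(ltW t0)// ler_pdivrMr// mul1r ler_nat.
by rewrite -ltnS.
Qed.

Lemma ball_values_min : exists2 y, norm2 y <= 1 &
  is_minimum (ball_values q t c G) (gauge_integral y).
Proof.
have [C phiC] := gauge_integral_lip; have [y y1 ymin] := min_ball phiC.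
exists y => //; split; first by exists y.
by move=> _ [z z1 <-]; exact: ymin.
Qed.

Lemma trapezoid_weights_ge0 K k : 0 <= trapezoid_weights t K k 0.
Proof.
by rewrite mxE mulr_ge0 ?divr_ge0 ?(ltW t0)//; case: ifP.
Qed.

(** Since the weights are nonnegative, the best [theta] consists of the norms at the nodes, and the
    epigraph problem reduces to minimising [gauge_trapezoid] over the ball. *)
Lemma trapezoid_values_min K : exists2 y, norm2 y <= 1 &
  is_minimum (trapezoid_values q t c G K) (gauge_trapezoid K y) /\
  forall z, norm2 z <= 1 -> gauge_trapezoid K y <= gauge_trapezoid K z.
Proof.
have [C phiC] := gauge_trapezoid_lip K; have [y y1 ymin] := min_ball phiC.
exists y => //; split => //; split.
  exists y, (\col_k pnorm q ((G (k%:R * (t / K%:R)))^T *m y)).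
  by split => // k; rewrite mxE ?pnorm_ge0.
move=> _ [z [theta [theta_ge _ z1 ->]]]; rewrite (le_trans (ymin _ z1))// lerD2l.
apply: ler_sum => k _; rewrite ler_wpM2l ?trapezoid_weights_ge0//.
by rewrite mxE.
Qed.

(** The threshold for [K] does not depend on [y]; this uniformity is what makes the minima
    converge. *)
Lemma gauge_trapezoid_cvg (e : R) : 0 < e ->
  \forall K \near \oo, forall y, norm2 y <= 1 ->
    `|gauge_trapezoid K y - gauge_integral y| <= e.
Proof.
move=> e0; have et0 : 0 < e / t by rewrite divr_gt0.
have [d d0 dP] := uniform_continuous_mulmx cG t et0.
exists (Num.truncn (t / d)).+1 => // K /= dK y y1.
have K0 : (0 < K)%N by exact: leq_trans dK.
have Kd : t / K%:R < d.
  rewrite ltr_pdivrMr ?ltr0n// mulrC -ltr_pdivrMr// (lt_le_trans (truncnS_gt _))//.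
  by rewrite ler_nat.
rewrite /gauge_trapezoid /gauge_integral opprD addrACA subrr add0r.
have tn0 : t != 0 by rewrite gt_eqF.
rewrite -[leRHS](divfK tn0).
apply: (@trapezoid_error _ t (e / t) K (gauge y)) => //; first exact: ltW.
  exact: integrable_gauge.
move=> s s' st _ ss'; rewrite (le_trans (pnorm_lip _ _ qp))//.
by apply: dP => //; exact: le_lt_trans Kd.
Qed.

Lemma trapezoid_values_cvg :
  inf (trapezoid_values q t c G K) @[K --> \oo] --> inf (ball_values q t c G).
Proof.
have [y y1 ymin] := ball_values_min; rewrite (is_minimum_inf ymin).
apply/cvgrPdist_le => e e0; apply: filterS (gauge_trapezoid_cvg e0) => K Ke.
have [z z1 [zmin zle]] := trapezoid_values_min K; rewrite (is_minimum_inf zmin).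
have yz : gauge_integral y <= gauge_integral z by apply: ymin.2; exists z.
have := zle _ y1; have := Ke _ y1; have := Ke _ z1.
rewrite !ler_norml => /andP[? ?] /andP[? ?] ?; apply/andP; split; lra.
Qed.

Lemma gauge_integral0 : gauge_integral 0 = 0.
Proof.
rewrite /gauge_integral dot0r add0r -[RHS](mul0r (t - 0)) -Rintegral_cst_itv ?(ltW t0)//.
by apply: eq_Rintegral => s _; rewrite mulmx0 pnorm0// (hoelder_pair_ge1 qp).
Qed.

Lemma gauge_integralZ (a : R) y : 0 <= a ->
  gauge_integral (a *: y) = a * gauge_integral y.
Proof.
move=> a0; rewrite /gauge_integral dotZr mulrDr -RintegralZl//; last first.
  exact: integrable_gauge.
congr (_ + _); apply: eq_Rintegral => s _.
by rewrite -scalemxAr pnormZ ?ger0_norm// (hoelder_pair_ge1 qp).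
Qed.

(* By positive homogeneity a negative minimum over the ball is attained on the
   sphere. *)
Lemma ball_values_sphere : inf (ball_values q t c G) < 0 ->
  exists2 y, norm2 y = 1 & gauge_integral y = inf (ball_values q t c G).
Proof.
have [y y1 ymin] := ball_values_min; rewrite (is_minimum_inf ymin) => y0.
have yN0 : y != 0 by apply: contraTneq y0 => ->; rewrite gauge_integral0 ltxx.
have yn := norm2_gt0 yN0; have z1 := norm2_normalize yN0.
exists ((norm2 y)^-1 *: y) => //; apply/eqP; rewrite eq_le; apply/andP; split.
  rewrite gauge_integralZ ?invr_ge0 ?(ltW yn)//.
  by rewrite ler_neMl ?invf_ge1// ltW.
by apply: ymin.2; exists ((norm2 y)^-1 *: y) => //=; rewrite z1.
Qed.

Lemma ball_values_le0 : inf (ball_values q t c G) <= 0.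
Proof.
have [y y1 ymin] := ball_values_min; rewrite (is_minimum_inf ymin).
rewrite -gauge_integral0; apply: ymin.2; exists 0 => //=.
by rewrite norm2_le1 dot0r ler01.
Qed.

End Gauge_integral.


(** * Two agents *)

Section Two_agents.
Context (R : realType) (n m N : nat) (p q : \bar R) (t : R).
Context (A : 'M[R]_n) (B : 'M[R]_(n, m)) (x0A x0B : 'cV[R]_n) (lA lB : R -> R).
Hypothesis n_gt0 : (0 < n)%N.
Hypothesis AN : A ^+ N = 0.
Hypothesis pq : hoelder_pair p q.
Hypothesis t0 : 0 < t.
Hypothesis clA : continuous lA.
Hypothesis clB : continuous lB.
Hypothesis lA_gt0 : forall s, 0 <= s <= t -> 0 < lA s.
Hypothesis lB_gt0 : forall s, 0 <= s <= t -> 0 < lB s.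
Notation mu := (@lebesgue_measure R).

(** Indexed by elapsed time, whereas [G] is indexed by time to go: [G (t - s) = l s *: Phi s]. *)
Let Phi (s : R) : 'M[R]_(n, m) := exp_poly A N (t - s) *m B.
Let XA := reach_set A B t x0A (pball p lA).
Let XB := reach_set A B t x0B (pball p lB).
Let c := cvec A t x0A x0B.
Let G := Gmx A B t lA lB.
Let l (s : R) : R := lA s + lB s.

Let cE i j : continuous (fun s => exp_poly A N s i j).
Proof.
rewrite (_ : (fun s => _) = (fun s => \sum_(k < N) divpow k s * (A ^+ k) i j)).
  apply: continuous_sum => k s; apply: cvgM; last exact: cvg_cst.
  exact: continuous_divpow.
by apply/funext => s; rewrite /exp_poly summxE; apply: eq_bigr => k _; rewrite mxE.
Qed.

Let cEB i j : continuous (fun s => (exp_poly A N s *m B) i j).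
Proof.
rewrite (_ : (fun s => _) = (fun s => \sum_k exp_poly A N s i k * B k j)).
  apply: continuous_sum => k s; apply: cvgM; last exact: cvg_cst.
  exact: cE.
by apply/funext => s; rewrite mxE.
Qed.

Let c_sub : continuous (fun s : R => t - s).
Proof. by move=> s; apply: cvgB; [exact: cvg_cst|exact: cvg_id]. Qed.

Let cPhi i j : continuous (fun s => Phi s i j).
Proof.
move=> s; apply: (@continuous_comp _ _ _ (fun s => t - s)
  (fun s => (exp_poly A N s *m B) i j)); first exact: c_sub.
exact: cEB.
Qed.

Let cl : continuous l.
Proof. by move=> s; apply: cvgD; [exact: clA|exact: clB]. Qed.

Let GE s : G s = l (t - s) *: (exp_poly A N s *m B).
Proof. by rewrite /G /Gmx (expm_nilpotent _ AN). Qed.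

Lemma Gmx_continuous i j : continuous (fun s => G s i j).
Proof.
rewrite (_ : (fun s => _) = (fun s => l (t - s) * (exp_poly A N s *m B) i j)).
  move=> s; apply: cvgM; last exact: cEB.
  by apply: (@continuous_comp _ _ _ (fun s => t - s) l); [exact: c_sub|exact: cl].
by apply/funext => s; rewrite GE mxE.
Qed.

Lemma reach_set_steer (x0 : 'cV[R]_n) (l' : R -> R) : continuous l' ->
  reach_set A B t x0 (pball p l') =
  [set z | exists2 u, admissible p t l' u &
    z = exp_poly A N t *m x0 + steer t Phi u].
Proof.
move=> cl'; rewrite (reach_setE _ _ AN (ltW t0)).
  apply/seteqP; split=> z [u]; first by move=> [mu ul ->]; exists u.
  by move=> [mu ul] ->; exists u.
have [M lM] := continuous_ubound_itv t cl'.
exists M => s v j st vl; rewrite (le_trans (ler_coord_pnorm _ _ (hoelder_pair_ge1 pq)))//.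
exact: le_trans (lM _ st).
Qed.

Let l_gt0 s : 0 <= s <= t -> 0 < l s.
Proof. by move=> st; rewrite addr_gt0 ?lA_gt0 ?lB_gt0. Qed.

Let qp := hoelder_pair_sym pq.

Let pnormN (v : 'cV[R]_m) : pnorm q (- v) = pnorm q v.
Proof.
by rewrite -scaleN1r pnormZ ?normrN ?normr1 ?mul1r// (hoelder_pair_ge1 qp).
Qed.

Lemma Rintegral_gauge_Gmx y :
  \int[mu]_(s in `[0, t]) pnorm q ((G s)^T *m y) =
  \int[mu]_(s in `[0, t]) (l s * pnorm q ((Phi s)^T *m y)).
Proof.
rewrite -[RHS]Rintegral_reflect ?(ltW t0)//; last first.
  exact: (continuous_integrand pq cPhi cl).
apply: eq_Rintegral => s; rewrite inE /= in_itv /= => /andP[s0 st].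
rewrite GE /Phi subKr linearZ /= -scalemxAl pnormZ ?(hoelder_pair_ge1 qp)//.
by rewrite gtr0_norm// l_gt0// subr_ge0 st gerBl.
Qed.

Lemma cvecE : c = exp_poly A N t *m x0A - exp_poly A N t *m x0B.
Proof. by rewrite /c /cvec (expm_nilpotent _ AN) mulmxBr. Qed.

Let norm2N (y : 'cV[R]_n) : norm2 (- y) = norm2 y.
Proof. by rewrite /norm2 dotNl dotNr opprK. Qed.

(** The q-norm is even, so in direction [- y] the second agent contributes the same integrand with
    weight [lB]; the two free motions combine to [c]. *)
Lemma support_gap y : norm2 y <= 1 ->
  support_fun XA y + support_fun XB (- y) = gauge_integral q t c G y.
Proof.
move=> y1; rewrite /XA /XB !reach_set_steer//.
rewrite (support_steer pq t0 cPhi clA)//; last by move=> s /lA_gt0/ltW.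
rewrite (support_steer pq t0 cPhi clB) ?norm2N//; last by move=> s /lB_gt0/ltW.
under [X in _ + (_ + X)]eq_Rintegral do rewrite mulmxN pnormN.
rewrite /gauge_integral Rintegral_gauge_Gmx cvecE addrACA; congr (_ + _).
  by rewrite dotNl -dotNr -dotDr dotC.
rewrite -RintegralD//; [|exact: (integrable_integrand t pq cPhi clA)|
  exact: (integrable_integrand t pq cPhi clB)].
by apply: eq_Rintegral => s _; rewrite mulrDl.
Qed.

Lemma sphere_values_min :
  is_minimum (sphere_values XA XB) (inf (sphere_values XA XB)) /\
  exists2 y, norm2 y = 1 & inf (sphere_values XA XB) = gauge_integral q t c G y.
Proof.
have [C phiC] := gauge_integral_lip c pq t0 Gmx_continuous.
have [y y1 ymin] := min_sphere n_gt0 phiC.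
have S_min : is_minimum (sphere_values XA XB) (gauge_integral q t c G y).
  split; first by exists y => //; rewrite support_gap// y1.
  by move=> _ [z z1 <-]; rewrite support_gap ?z1//; exact: ymin.
by rewrite (is_minimum_inf S_min); split=> //; exists y.
Qed.

(** The agents receive the fractions [lA / l] and [- lB / l] of [w]; the minus sign compensates for
    subtracting the second steered vector. *)
Lemma admissible_split w : admissible p t l w ->
  exists uA uB, [/\ admissible p t lA uA, admissible p t lB uB
    & steer t Phi w = steer t Phi uA - steer t Phi uB].
Proof.
move=> aw; have p1 := hoelder_pair_ge1 pq.
have share (l' : R -> R) (e : R) : continuous l' -> `|e| = 1 ->
    (forall s, 0 <= s <= t -> 0 < l' s) ->
    admissible p t l' (fun s => (e * (l' s / l s)) *: w s).
  move=> cl' e1 l'0; split=> [j|s st].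
    rewrite (_ : (fun s => _) = (fun s => (e * (l' s / l s)) * w s j 0)); last first.
      by apply/funext => s; rewrite mxE.
    apply: measurable_funM; last by have [] := aw.
    (* Positivity of [l] is known on [[0, t]], so the quotient is shown continuous within that
       interval. *)
    apply: subspace_continuous_measurable_fun => //.
    rewrite continuous_subspace_in => s; rewrite inE /= in_itv /= => st.
    have ws (f : R -> R) : continuous f ->
        {within `[0, t], continuous f} by exact: continuous_subspaceT.
    apply: cvgM; first exact: cvg_cst.
    apply: cvgM; first exact: ws cl' s.
    by apply: cvgV; [rewrite gt_eqF// l_gt0|exact: ws cl s].
  rewrite pnormZ// normrM e1 mul1r ger0_norm ?divr_ge0 ?(ltW (l'0 _ _)) ?(ltW (l_gt0 _))//.
  rewrite mulrAC ler_pdivrMr ?l_gt0// ler_wpM2l ?(ltW (l'0 _ _))//.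
  by have [_ ->] := aw.
have aA := share lA 1 clA (normr1 _) lA_gt0.
have aB := share lB (-1) clB (normrN1 _) lB_gt0.
exists (fun s => (1 * (lA s / l s)) *: w s), (fun s => (-1 * (lB s / l s)) *: w s).
split=> //.
have bA j := admissible_bounded pq clA j aA.
have bB j := admissible_bounded pq clB j aB.
rewrite -[X in X - _]scale1r -scaleN1r -(steer_lin cPhi _ _ bA bB).
apply: eq_vint => s; rewrite /= in_itv /= => st; congr (_ *m _).
rewrite !scalerA -scalerDl -[LHS]scale1r; congr (_ *: _).
by have := l_gt0 st; rewrite /l => ls; field; rewrite gt_eqF.
Qed.

Lemma reach_sets_meet : (forall y, norm2 y = 1 -> 0 <= gauge_integral q t c G y) ->
  XA `&` XB !=set0.
Proof.
move=> phi0; have l_ge0 s st := ltW (@l_gt0 s st).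
have [w aw wmin] := steer_min_norm pq t0 cPhi cl l_ge0 c.
set z0 := c + steer t Phi w in wmin.
have [z00|z0N] := eqVneq z0 0.
  (* The end states of the two agents under the split controls differ by [z0], which is 0. *)
  have [uA [uB [aA aB wE]]] := admissible_split aw.
  exists (exp_poly A N t *m x0A + steer t Phi uA); split.
    by rewrite /XA reach_set_steer//; exists uA.
  rewrite /XB reach_set_steer//; exists uB => //; apply/eqP; rewrite -subr_eq0.
  by rewrite -[X in _ == X]z00 /z0 cvecE wE opprD addrACA.
have z0_gt0 := dot_gt0 z0N; have nz0 := norm2_gt0 z0N.
(* Otherwise the vector z0 + th (z - z0) is shorter than z0. *)
have var u : admissible p t l u -> dot z0 z0 <= dot z0 (c + steer t Phi u).
  move=> au; set z := c + steer t Phi u; rewrite leNgt; apply/negP => zz0.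
  pose D := dot (z - z0) (z - z0).
  have D0 : 0 <= D by exact: dot_ge0.
  pose g := dot z0 z0 - dot z0 z; have g0 : 0 < g by rewrite subr_gt0.
  (* At step [th] the squared norm changes by [th * (th * D) - 2 * (th * g)]. Since
     [th * (D + g) = g], the first term is at most [th * g] and the change is negative; the summand
     [g] in the divisor also gives [th <= 1]. *)
  pose th := g / (D + g).
  have Dg : 0 < D + g by rewrite ltr_wpDl.
  have th0 : 0 < th by rewrite divr_gt0.
  have th1 : th <= 1 by rewrite ler_pdivrMr// mul1r lerDr.
  have ab : (1 - th) + th = 1 by rewrite subrK.
  have th1' : 0 <= 1 - th by rewrite subr_ge0.
  have a' := admissible_convex pq cl th1' (ltW th0) ab aw au.
  have := wmin _ a'.
  have bw j := admissible_bounded pq cl j aw.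
  have bu j := admissible_bounded pq cl j au.
  rewrite (steer_lin cPhi _ _ bw bu).
  have -> : c + ((1 - th) *: steer t Phi w + th *: steer t Phi u) =
      z0 + th *: (z - z0).
    rewrite /z0 /z; apply/colP => i; rewrite !mxE; ring.
  rewrite dot_sqr_shift -/D [dot z0 (z - z0)]dotDr dotNr.
  have -> : dot z0 z - dot z0 z0 = - g by rewrite opprB.
  have hth : th * (D + g) = g by rewrite divfK// gt_eqF.
  have : 0 < th * g by rewrite mulr_gt0.
  have : th * (th * D) <= th * g.
    by rewrite ler_wpM2l ?(ltW th0)// -[leRHS]hth ler_wpM2l ?(ltW th0)// lerDl ltW.
  lra.
have : 0 <= gauge_integral q t c G (- (norm2 z0)^-1 *: z0).
  apply: phi0; rewrite scaleNr norm2N; exact: norm2_normalize.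
have y1 : norm2 (- (norm2 z0)^-1 *: z0) <= 1.
  by rewrite scaleNr norm2N norm2_normalize.
(* The gauge integral is read back as the support function of the vectors [c + steer t Phi u]; by
   the variational inequality it is at most [- |z0|] in this direction. *)
rewrite /gauge_integral Rintegral_gauge_Gmx dotC.
rewrite -(support_steer pq t0 cPhi cl l_ge0 _ y1) leNgt => /negP[].
apply: (@le_lt_trans _ _ (- (norm2 z0)^-1 * dot z0 z0)); last first.
  by rewrite mulNr oppr_lt0 mulr_gt0// invr_gt0.
apply: ge_sup.
  by exists (dot (- (norm2 z0)^-1 *: z0) (c + steer t Phi w)), z0 => //; exists w.
move=> _ [_ [u au ->] <-]; rewrite dotZl !mulNr lerN2 ler_wpM2l ?invr_ge0 ?(ltW nz0)//.
exact: var.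
Qed.

(** A common point [z] has [<y, z> + <- y, z> = 0], and each summand is below a support function.
    Hoelder's bound ensures that the suprema are those of bounded sets. *)
Lemma reach_sets_meet_ge0 : XA `&` XB !=set0 ->
  forall y, norm2 y <= 1 -> 0 <= gauge_integral q t c G y.
Proof.
move=> [z [zA zB]] y y1; rewrite -support_gap//.
have sup_ge (x0 : 'cV[R]_n) (l' : R -> R) v : continuous l' ->
    reach_set A B t x0 (pball p l') z -> dot v z <=
    support_fun (reach_set A B t x0 (pball p l')) v.
  move=> cl' zX; apply: ub_le_sup; last by exists z.
  exists (dot v (exp_poly A N t *m x0) +
    \int[mu]_(s in `[0, t]) (l' s * pnorm q ((Phi s)^T *m v))).
  rewrite reach_set_steer// => _ [_ [u au ->] <-]; rewrite dotDr lerD2l.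
  exact: (dot_steer_le pq cPhi cl').
have := sup_ge _ _ y clA zA; have := sup_ge _ _ (- y) clB zB.
by rewrite dotNl /XA /XB; lra.
Qed.

(** The sphere lies in the ball, so [ptilde <= pstar]; a negative [ptilde] is attained on the
    sphere, which forces equality. *)
Lemma reach_sets_separation :
  let pstar := inf (sphere_values XA XB) in
  let ptilde := inf (ball_values q t c G) in
  [/\ (ptilde = 0 -> 0 <= pstar), (0 <= pstar <-> XA `&` XB !=set0)
    & ptilde < 0 -> ptilde = pstar /\ pstar < 0].
Proof.
move=> pstar ptilde; have [[_ lbS] [y y1 yE]] := sphere_values_min.
have phi_ge z : norm2 z = 1 -> pstar <= gauge_integral q t c G z.
  by move=> z1; apply: lbS; exists z => //; rewrite support_gap// z1.
have [b b1 [bS bmin]] := ball_values_min c pq t0 Gmx_continuous.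
have ptE := is_minimum_inf (conj bS bmin).
have pt_le z : norm2 z <= 1 -> ptilde <= gauge_integral q t c G z.
  by move=> z1; rewrite /ptilde ptE; apply: bmin; exists z.
have le_star : ptilde <= pstar by rewrite /pstar yE pt_le// y1.
split=> [pt0||pt0].
- by rewrite -pt0.
- split=> [ps0|XAB]; last by rewrite /pstar yE reach_sets_meet_ge0// y1.
  by apply: reach_sets_meet => z z1; rewrite (le_trans ps0)// phi_ge.
have [z z1 zE] := ball_values_sphere pq t0 Gmx_continuous pt0.
have star_pt : ptilde = pstar.
  by apply/eqP; rewrite eq_le le_star /= /ptilde -zE phi_ge.
by split=> //; rewrite -star_pt.
Qed.

End Two_agents.

(** * Independence of the values of the bounds outside the time interval *)

Section Bounds_on_interval.
Context (R : realType) (n m : nat) (p q : \bar R) (t : R).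
Context (A : 'M[R]_n) (B : 'M[R]_(n, m)).

Lemma eq_reach_set (x0 : 'cV[R]_n) (l l' : R -> R) :
  (forall s, 0 <= s <= t -> l s = l' s) ->
  reach_set A B t x0 (pball p l) = reach_set A B t x0 (pball p l').
Proof.
move=> ll'; apply/seteqP; split=> z [u [x [mu uU xs zx]]]; exists u, x; split=> // s st;
  have := uU _ st; by rewrite /pball /= ll'.
Qed.

Lemma eq_ball_values (c : 'cV[R]_n) (G G' : R -> 'M[R]_(n, m)) :
  (forall s, 0 <= s <= t -> G s = G' s) ->
  ball_values q t c G = ball_values q t c G'.
Proof.
move=> GG'; apply: eq_imagel => y _; congr (_ + _); apply: eq_Rintegral => s.
by rewrite inE /= in_itv /= => st; rewrite GG'.
Qed.

Lemma eq_trapezoid_values (c : 'cV[R]_n) (G G' : R -> 'M[R]_(n, m)) K :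
  0 <= t -> (forall s, 0 <= s <= t -> G s = G' s) ->
  trapezoid_values q t c G K = trapezoid_values q t c G' K.
Proof.
move=> t0 GG'; have node (k : 'I_K.+1) :
    G (k%:R * (t / K%:R)) = G' (k%:R * (t / K%:R)).
  (* For [K = 0] the step is [t / 0 = 0], and the only node is 0. *)
  apply: GG'; rewrite mulr_ge0 ?divr_ge0//=; have [K0|K0] := posnP K.
    by rewrite (_ : K%:R = 0 :> R) ?invr0 ?mulr0// K0.
  by rewrite mulrCA ler_piMr// ler_pdivrMr ?ltr0n// mul1r ler_nat -ltnS.
apply/seteqP; split=> v [y [theta [h1 h2 h3 h4]]]; exists y, theta; split=> // k.
  by rewrite -node.
by rewrite node.
Qed.

End Bounds_on_interval.

(** Replacing a bound by its extension makes the later integrands continuous on the whole line, with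
    no one-sided continuity at the ends of the interval. *)
Lemma smooth_on_continuous (R : realType) (t : R) (l : R -> R) :
  smooth_on t l ->
  exists2 g : R -> R, continuous g & forall s, 0 <= s <= t -> l s = g s.
Proof.
move=> [g [dg lg]]; exists g => // s.
exact/differentiable_continuous/derivable1_diffP/(dg 0%N s).
Qed.

(** [inf] takes a default value on sets without an infimum, so the first block certifies that the
    optimal values are attained minima. The truncation error tends to 0 by letting the number [K] of
    steps tend to infinity. *)
Theorem theorem2 (R : realType) (m : nat) (r : 'I_m -> nat) (t : R)
    (p q : \bar R) (x0A x0B : 'cV[R]_(\sum_(j < m) r j)) (lA lB : R -> R)
    (m_gt0 : (0 < m)%N)
    (r_gt0 : forall j : 'I_m, (0 < r j)%N)
    (t_gt0 : 0 < t)
    (p_ge1 : (1 <= p)%E)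
    (pq_conj : (p^-1 + q^-1 = 1)%E)
    (lA_smooth : smooth_on t lA)
    (lB_smooth : smooth_on t lB)
    (lA_gt0 : forall s : R, 0 <= s <= t -> 0 < lA s)
    (lB_gt0 : forall s : R, 0 <= s <= t -> 0 < lB s) :
  let A := Amx R r in
  let B := Bmx R r in
  let XA := reach_set A B t x0A (pball p lA) in
  let XB := reach_set A B t x0B (pball p lB) in
  let c := cvec A t x0A x0B in
  let G := Gmx A B t lA lB in
  let pstar := inf (sphere_values XA XB) in
  let ptilde := inf (ball_values q t c G) in
  let ptilde_eps := fun K : nat => inf (trapezoid_values q t c G K) in
  [/\ [/\ is_minimum (sphere_values XA XB) pstar,
          is_minimum (ball_values q t c G) ptilde
        & forall K : nat, (0 < K)%N ->
            is_minimum (trapezoid_values q t c G K) (ptilde_eps K)],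
      ptilde_eps K @[K --> \oo] --> ptilde,
      ptilde <= 0,
      (ptilde = 0 -> 0 <= pstar) /\ (0 <= pstar <-> XA `&` XB !=set0)
    & (ptilde < 0 -> ptilde = pstar /\ pstar < 0) /\
      (pstar < 0 <-> XA `&` XB = set0)].
Proof.
have [gA cgA lgA] := smooth_on_continuous lA_smooth.
have [gB cgB lgB] := smooth_on_continuous lB_smooth.
move=> A B XA XB c G pstar ptilde ptilde_eps.
have pq := hoelder_pairP p_ge1 pq_conj.
have AN : A ^+ (\sum_(j < m) r j) = 0 by exact: Amx_nilpotent.
(* Positive dimension makes the unit sphere nonempty. *)
have n_gt0 : (0 < \sum_(j < m) r j)%N.
  by rewrite (bigD1 (Ordinal m_gt0))//= addn_gt0 r_gt0.
have XAE : XA = reach_set A B t x0A (pball p gA) by exact: eq_reach_set.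
have XBE : XB = reach_set A B t x0B (pball p gB) by exact: eq_reach_set.
have GE s : 0 <= s <= t -> G s = Gmx A B t gA gB s.
  (* [G] samples the bounds at [t - s], which stays in [[0, t]]. *)
  move=> /andP[s0 st]; have ts : 0 <= t - s <= t by rewrite subr_ge0 st gerBl.
  by rewrite /G /Gmx lgA// lgB.
have bE : ball_values q t c G = ball_values q t c (Gmx A B t gA gB).
  exact: eq_ball_values.
have tE K : trapezoid_values q t c G K = trapezoid_values q t c (Gmx A B t gA gB) K.
  exact/eq_trapezoid_values/GE/ltW.
have gA_gt0 s : 0 <= s <= t -> 0 < gA s by move=> st; rewrite -lgA// lA_gt0.
have gB_gt0 s : 0 <= s <= t -> 0 < gB s by move=> st; rewrite -lgB// lB_gt0.
have cG := Gmx_continuous (t := t) (B := B) AN cgA cgB.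
have [S_min _] := sphere_values_min B x0A x0B
  n_gt0 AN pq t_gt0 cgA cgB gA_gt0 gB_gt0.
have [pt0 ps_ge pt_lt] :=
  reach_sets_separation B x0A x0B
  n_gt0 AN pq t_gt0 cgA cgB gA_gt0 gB_gt0.
rewrite /ptilde_eps /ptilde /pstar XAE XBE bE.
split; [split| | | |].
- exact: S_min.
- have [y _ ymin] := ball_values_min c pq t_gt0 cG.
  by rewrite (is_minimum_inf ymin).
- move=> K _; rewrite tE; have [y _ [ymin _]] := trapezoid_values_min c pq t_gt0 cG K.
  by rewrite (is_minimum_inf ymin).
- have -> : (fun K => inf (trapezoid_values q t c G K)) =
      (fun K => inf (trapezoid_values q t c (Gmx A B t gA gB) K)).
    by apply/funext => K; rewrite tE.
  exact: (trapezoid_values_cvg pq t_gt0 cG).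
- exact: (ball_values_le0 c pq t_gt0 cG).
- by split.
(* Disjointness is the negation of meeting, so this is the contrapositive of the equivalence for
   [0 <= pstar]. *)
split=> //; rewrite ltNge; split=> [/negP ps_lt|XAB].
  by apply/eqP/negPn/negP => /set0P /ps_ge.
by apply/negP => /ps_ge/set0P; rewrite XAB eqxx.
Qed.
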